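(* Assume that the residual characteristic of $F$ is odd. Let $S=\begin{bmatrix}a&\\&1\end{bmatrix}$, where $-a\in\mathfrak o$ is a non-square, let $L=F(\sqrt{-a})$, and let $\Lambda$ be a character of $L^\times$ such that $\Lambda|_{F^\times}=1$. Let $$m_0=\min\{m\ge0:\Lambda|_{1+\varpi^m\mathfrak o[\sqrt{-a}]}=1\}$$ and suppose that $m_0\ge2$ and $2m_0-3\ge v(a)$. Let $u_0\in\mathfrak o^\times$ be such that $\Lambda(1+\varpi^{m_0-1}y\sqrt{-a})=\psi(\varpi^{-1}u_0y)$ for all $y\in\mathfrak o$. Then, for $\alpha\in\varpi^{1-m_0}u_0(1+\mathfrak p)$ and $\beta\in\varpi(1+\mathfrak p)$, $$B_{\Lambda,\theta_S}(d_{\alpha,\beta}^{-1}\cdot f^\pm_{\rm min})=q^{-4m_0+7}.$$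
   Context: $F$ is a non-archimedean local field of characteristic zero with ring of integers $\mathfrak o$, maximal ideal $\mathfrak p$, uniformizer $\varpi$, normalized valuation $v$, $q=\#(\mathfrak o/\mathfrak p)$, $|\varpi|=q^{-1}$. $\psi$ is a character of $F$ trivial on $\mathfrak o$ but not on $\mathfrak p^{-1}$, and $\psi_0(x)=\psi(\varpi^{-1}x)$. The Haar measure on $F$ gives $\mathfrak o$ volume $1$. $G=\mathrm{GSp}_4(F)=\{g\in\mathrm{GL}_4(F):{}^tgJg=\mu(g)J,\ \mu(g)\in F^\times\}$ with $J=\begin{bmatrix}&&&1\\&&1\\&-1\\-1\end{bmatrix}$; $Z$ is its center. Let $K'=G\cap\begin{bmatrix}1+\mathfrak p&\mathfrak o&\mathfrak o&\mathfrak o\\\mathfrak p&1+\mathfrak p&\mathfrak o&\mathfrak o\\\mathfrak p&\mathfrak p&1+\mathfrak p&\mathfrak o\\\mathfrak p&\mathfrak p&\mathfrak p&1+\mathfrak p\end{bmatrix}$ and $H=ZK'$. For a fixed $t\in\mathfrak o^\times$, $\chi=\chi_{1,1,t}:H\to\mathbb C^\times$ is $\chi(zk)=\psi_0(k_{12}+k_{23}+t\varpi^{-1}k_{41})$ for $z\in Z$, $k\in K'$. Let $g_\chi=\begin{bmatrix}0&0&1&0\\0&0&0&-1\\-\varpi/t&0&0&0\\0&\varpi/t&0&0\end{bmatrix}$, $H'=H\sqcup g_\chi H$, and $\chi^\pm:H'\to\mathbb C^\times$, $\chi^\pm(h)=\chi(h)$, $\chi^\pm(g_\chi h)=\pm\chi(h)$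 for $h\in H$. Then $\sigma_\chi^\pm=\text{c-Ind}_{H'}^G(\chi^\pm)$, realized on functions $f:G\to\mathbb C$ with $f(hg)=\chi^\pm(h)f(g)$ for $h\in H'$, with $G$ acting by right translation. The minimal vector $f^\pm_{\rm min}$ equals $\chi^\pm$ on $H'$ and zero outside $H'$. The inner product is $\langle f_1,f_2\rangle=\mathrm{vol}(Z\backslash H')^{-1}\int_{Z\backslash G}f_1(x)\overline{f_2(x)}\,dx$. For $\alpha,\beta\in F^\times$, $d_{\alpha,\beta}=\mathrm{diag}(\alpha^2\beta,\alpha\beta,\alpha,1)$. Bessel data for $S=\begin{bmatrix}a&\\&1\end{bmatrix}$: $T_S=\{g\in\mathrm{GL}_2(F):{}^tgSg=\det(g)S\}=\{\begin{bmatrix}x&y\\-ay&x\end{bmatrix}\in\mathrm{GL}_2(F)\}$, identified with $L^\times$ by $\phi_S:\begin{bmatrix}x&y\\-ay&x\end{bmatrix}\mapsto x+y\sqrt{-a}$, and $\Lambda_S=\Lambda\circ\phi_S$. $T_S$ is embedded in $G$ by $g\mapsto\begin{bmatrix}g&\\&\det(g)g'\end{bmatrix}$, $g'=\begin{bmatrix}&1\\1&\end{bmatrix}{}^tg^{-1}\begin{bmatrix}&1\\1&\end{bmatrix}$. $N$ is the group of matrices $n=\begin{bmatrix}1&&u&z\\&1&w&u\\&&1\\&&&1\end{bmatrix}$ with measure $dn=du\,dw\,dz$, and $\theta_S(n)=\psi(az+w)$. The Haar measure $dt$ on $F^\times\backslash T_S$ is normalized by $\int_{F^\times\backslash T_S}\mathcal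 F(t)\,dt=\int_F\mathcal F(\phi_S^{-1}(1+y\sqrt{-a}))|1+ay^2|^{-1}\,dy$. For a non-zero vector $v$ in $\sigma_\chi^\pm$, $$B_{\Lambda,\theta_S}(v)=\frac1{\langle v,v\rangle}\int_{F^\times\backslash T_S}\int_N^{\rm st}\langle tn\,v,v\rangle\,\Lambda_S^{-1}(t)\,\theta_S^{-1}(n)\,dn\,dt,$$ where $\int_N^{\rm st}$ is the stable integral, i.e. the common value of the integrals over all sufficiently large compact open subgroups of $N$. When $m_0\ge2$, the map $y\mapsto\Lambda(1+\varpi^{m_0-1}y\sqrt{-a})$ is a non-trivial additive character of $\mathfrak o$ trivial on $\mathfrak p$, so a $u_0$ as in the claim exists. *)

(* Defs.v *)
From HB Require Import structures.
From mathcomp Require Import all_boot all_order all_algebra all_field.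
From mathcomp Require Import complex.
From mathcomp Require Import all_classical all_reals all_analysis.

Set Implicit Arguments.
Unset Strict Implicit.
Unset Printing Implicit Defensive.

Import Order.TTheory GRing.Theory Num.Theory.
Local Open Scope classical_set_scope.
Local Open Scope ring_scope.

(* The fractional ideal of elements of valuation >= n; the value of v at 0 is
   irrelevant, 0 being regarded as an element of infinite valuation. *)
Definition vball (F : zmodType) (v : F -> int) (n : int) : set F :=
  [set x | x = 0 \/ n <= v x].

(* A non-archimedean local field: complete for a normalized discrete valuation
   whose residue field is finite, of cardinality [resq]. *)
HB.mixin Record Field_isLocal (F : Type) of GRing.Field F & Topological F := {
  nval : F -> int ;
  resq : nat ;
  nvalM : forall x y : F, x != 0 -> y != 0 -> nval (x * y) = nval x + nval y ;
  nvalD : forall x y : F, x != 0 -> y != 0 -> x + y != 0 ->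
    Num.min (nval x) (nval y) <= nval (x + y) ;
  nval_normalized : exists2 x : F, x != 0 & nval x = 1 ;
  nbhs_nval : forall (x : F) (A : set F),
    nbhs x A <-> exists n : int, forall y, vball nval n (y - x) -> A y ;
  nval_complete : forall u : nat -> F,
    (forall n : int, exists N : nat, forall i j : nat,
       (N <= i)%N -> (N <= j)%N -> vball nval n (u i - u j)) ->
    exists l : F, u @ \oo --> l ;
  (* [rep] is a system of representatives of o / p *)
  residue_finite : exists2 rep : 'I_resq -> F,
    forall i, vball nval 0 (rep i) &
    forall x, vball nval 0 x -> exists! i, vball nval 1 (x - rep i)
}.

#[short(type="localFieldType")]
HB.structure Definition LocalField :=
  {F of Field_isLocal F & GRing.Field F & Topological F}.

Arguments resq : clear implicits.

Section LocalFieldNotions.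
Variable F : localFieldType.

Definition pideal (n : int) : set F := vball nval n.
Definition ointegers : set F := pideal 0.
Definition ounits : set F := [set x | x != 0 /\ nval x = 0].

Definition uniformizer (w : F) : Prop := w != 0 /\ nval w = 1.

Definition residual_char (p : nat) : Prop := prime p /\ pideal 1 p%:R.

End LocalFieldNotions.

(* F with 0 as distinguished point, as measurable types have to be pointed. *)
Definition pointedF (F : localFieldType) : Type := F.
HB.instance Definition _ (F : localFieldType) := Choice.copy (pointedF F) F.
HB.instance Definition _ (F : localFieldType) :=
  isPointed.Build (pointedF F) (0 : F).

Definition borelF (F : localFieldType) :=
  @g_sigma_algebraType (pointedF F) (@open F).

Definition vabs (R : realType) (F : localFieldType) (x : F) : R :=
  if x == 0 then 0 else (resq F)%:R ^ (- nval x).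

(* The Haar measure on F, as a Borel measure, for which o has volume 1. *)
Definition is_haarF (R : realType) (F : localFieldType)
    (mu : set (borelF F) -> \bar R) : Prop :=
  (forall (x : F) (A : set (borelF F)), measurable A ->
     mu [set x + y | y in (A : set F)] = mu A) /\
  mu (@ointegers F) = 1%:E.

Definition cintegral d (T : measurableType d) (R : realType)
    (mu : {measure set T -> \bar R}) (D : set T) (f : T -> R[i]) : R[i] :=
  Complex (Rintegral mu D (fun x => complex.Re (f x)))
          (Rintegral mu D (fun x => complex.Im (f x))).

(* Characters are homomorphisms to C^* with open kernel. *)
Definition add_character (R : realType) (F : localFieldType)
    (psi : F -> R[i]) : Prop :=
  [/\ forall x, psi x != 0,
      forall x y, psi (x + y) = psi x * psi y &
      \forall x \near (0 : F), psi x = 1].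

(* For L = F(sqrt(-a)), s = sqrt(-a), the topology of L is that of F * F in the
   basis 1, s.  The value of Lambda at 0 is irrelevant. *)
Definition ext_character (R : realType) (F : localFieldType)
    (L : fieldExtType F) (s : L) (Lambda : L -> R[i]) : Prop :=
  [/\ forall z, z != 0 -> Lambda z != 0,
      forall z z', z != 0 -> z' != 0 -> Lambda (z * z') = Lambda z * Lambda z' &
      \forall p \near ((1, 0) : F * F), Lambda (p.1%:A + p.2 *: s) = 1].

(* Lambda is trivial on 1 + w^m o[s]; for m = 0 this set contains 0, where
   Lambda is not defined. *)
Definition trivial_at_level (R : realType) (F : localFieldType)
    (L : fieldExtType F) (w : F) (s : L) (Lambda : L -> R[i]) (m : nat) : Prop :=
  forall x y : F, ointegers x -> ointegers y ->
    let z := 1 + (w ^+ m) *: (x%:A + y *: s) in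
    z != 0 -> Lambda z = 1.

Definition is_min (P : nat -> Prop) (m : nat) : Prop :=
  P m /\ forall k, P k -> (m <= k)%N.

Definition mxrows (F : pzRingType) (m n : nat) (r : seq (seq F)) : 'M[F]_(m, n) :=
  \matrix_(i < m, j < n) nth 0 (nth [::] r i) j.

Section GSp4.
Variable F : localFieldType.
Implicit Types (g h z k : 'M[F]_4).

Definition Jmx : 'M[F]_4 := mxrows 4 4
  [:: [:: 0;   0;  0; 1];
      [:: 0;   0;  1; 0];
      [:: 0;  -1;  0; 0];
      [:: -1;  0;  0; 0]].

Definition GSp4 : set 'M[F]_4 :=
  [set g | g \in unitmx /\
           exists2 mu : F, mu != 0 & g^T *m Jmx *m g = mu *: Jmx].

Definition ZG : set 'M[F]_4 :=
  [set z | GSp4 z /\ forall g, GSp4 g -> z *m g = g *m z].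

Definition Kprime : set 'M[F]_4 :=
  [set k | GSp4 k /\ forall i j : 'I_4,
     if i == j then pideal 1 (k i j - 1)
     else if (i < j)%N then ointegers (k i j) else pideal 1 (k i j)].

Definition Hgrp : set 'M[F]_4 :=
  [set h | exists z k, [/\ ZG z, Kprime k & h = z *m k]].

Definition gchi (w t : F) : 'M[F]_4 := mxrows 4 4
  [:: [:: 0;        0;      1;  0];
      [:: 0;        0;      0; -1];
      [:: - (w / t); 0;     0;  0];
      [:: 0;        w / t;  0;  0]].

Definition gchiH (w t : F) : set 'M[F]_4 := [set gchi w t *m h | h in Hgrp].

Definition Hprime (w t : F) : set 'M[F]_4 := Hgrp `|` gchiH w t.

Definition dmx (alpha beta : F) : 'M[F]_4 := mxrows 4 4
  [:: [:: alpha ^+ 2 * beta; 0; 0; 0];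
      [:: 0; alpha * beta; 0; 0];
      [:: 0; 0; alpha; 0];
      [:: 0; 0; 0; 1]].

(* Inverse images in G of the open subsets of Z \ G.  The sigma-algebra they
   generate restricts on G to the inverse image of the Borel sigma-algebra of
   Z \ G, so that its measures on G are the Borel measures on Z \ G, and
   integrating a Z-invariant function on G is integrating over Z \ G. *)
Definition openZG : set (set 'M[F]_4) :=
  [set U | (exists2 V : set 'M[F]_4, open V & U = V `&` GSp4) /\
           forall z g, ZG z -> U g -> U (z *m g)].

Definition borelZG := @g_sigma_algebraType 'M[pointedF F]_4 openZG.

End GSp4.

Arguments GSp4 {F}.
Arguments ZG {F}.
Arguments Kprime {F}.
Arguments Hgrp {F}.

Definition is_haarZG (R : realType) (F : localFieldType)
    (nu : set (borelZG F) -> \bar R) : Prop :=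
  [/\ forall (g : 'M[F]_4) (A : set (borelZG F)),
        GSp4 g -> measurable A -> A `<=` GSp4 ->
        nu [set x *m g | x in (A : set 'M[F]_4)] = nu A,
      forall K : set 'M[F]_4, compact K -> K `<=` GSp4 ->
        (nu [set h | exists z k, [/\ ZG z, K k & h = z *m k]] < +oo)%E &
      forall U : set 'M[F]_4, openZG U -> U !=set0 -> (0 < nu U)%E].

Section Representation.
Variables (R : realType) (F : localFieldType).
Notation C := R[i].
(* Functions on G are represented by functions on all 4 x 4 matrices, whose
   values outside G play no role. *)
Notation fct := ('M[F]_4 -> C).

Definition chi (psi : F -> C) (w t : F) : fct := fun h =>
  xget 0 [set c | exists z k, [/\ ZG z, Kprime k, h = z *m k &
    c = psi (w^-1 * (k 0 1 + k 1 2 + t * w^-1 * k 3 0))]].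

(* chi^+ for eps = false, chi^- for eps = true, on H'. *)
Definition chi_pm (eps : bool) (psi : F -> C) (w t : F) : fct := fun h =>
  if h \in Hgrp then chi psi w t h
  else (-1) ^+ eps * chi psi w t (invmx (gchi w t) *m h).

Definition fmin (eps : bool) (psi : F -> C) (w t : F) : fct := fun g =>
  if g \in Hprime w t then chi_pm eps psi w t g else 0.

Definition rtrans (g : 'M[F]_4) (f : fct) : fct := fun x => f (x *m g).

(* The space of c-Ind_{H'}^G(chi^{+-}). *)
Definition cInd (eps : bool) (psi : F -> C) (w t : F) : set fct :=
  [set f | [/\
    forall h g, Hprime w t h -> GSp4 g ->
      f (h *m g) = chi_pm eps psi w t h * f g,
    exists2 V : set 'M[F]_4, nbhs (1%:M : 'M[F]_4) V &
      forall k g, V k -> GSp4 k -> GSp4 g -> f (g *m k) = f g &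
    exists K : set 'M[F]_4, [/\ compact K, K `<=` GSp4 &
      forall g, GSp4 g -> f g != 0 ->
        exists h k, [/\ Hprime w t h, K k & g = h *m k]]]].

Definition inner (nu : {measure set (borelZG F) -> \bar R}) (w t : F) (f1 f2 : fct) : C :=
  ((fine (nu (Hprime w t)))^-1)%:C%C *
  cintegral nu (GSp4 : set (borelZG F)) (fun x => f1 x * (f2 x)^*).

(* The element n of N with coordinates ((u, w), z). *)
Definition nmat (n : F * F * F) : 'M[F]_4 :=
  let u := n.1.1 in let w := n.1.2 in let z := n.2 in
  mxrows 4 4
    [:: [:: 1; 0; u; z];
        [:: 0; 1; w; u];
        [:: 0; 0; 1; 0];
        [:: 0; 0; 0; 1]].

Definition theta (psi : F -> C) (a : F) (n : F * F * F) : C :=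
  psi (a * n.2 + n.1.2).

Definition compact_open_subgroupN (U : set (F * F * F)) : Prop :=
  [/\ compact U, open U, (nmat @` U) 1%:M,
      forall m n, U m -> U n -> (nmat @` U) (nmat m *m nmat n) &
      forall n, U n -> (nmat @` U) (invmx (nmat n))].

Definition is_stable_integral (mu : {sigma_finite_measure set (borelF F) -> \bar R})
    (f : F * F * F -> C) (c : C) : Prop :=
  exists2 U0, compact_open_subgroupN U0 &
    forall U, compact_open_subgroupN U -> U0 `<=` U ->
      cintegral ((mu \x mu) \x mu)%E (U : set (borelF F * borelF F * borelF F))
        f = c.

Definition stable_integral mu (f : F * F * F -> C) : C :=
  xget 0 [set c | is_stable_integral mu f c].

(* The element of T_S corresponding to x + y sqrt(-a), and phi_S. *)
Definition TSmx (a x y : F) : 'M[F]_2 := mxrows 2 2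
  [:: [:: x; y]; [:: - (a * y); x]].

Definition phiS (L : fieldExtType F) (s : L) (g : 'M[F]_2) : L :=
  (g 0 0)%:A + g 0 1 *: s.

Definition TSembed (g : 'M[F]_2) : 'M[F]_4 :=
  let w2 : 'M[F]_2 := mxrows 2 2 [:: [:: 0; 1]; [:: 1; 0]] in
  block_mx g 0 0 (\det g *: (w2 *m (invmx g)^T *m w2)) : 'M[F]_(2 + 2).

(* Integral over F^* \ T_S for the prescribed normalization of dt. *)
Definition TSintegral (mu : {measure set (borelF F) -> \bar R}) (a : F)
    (f : 'M[F]_2 -> C) : C :=
  cintegral mu (setT : set (borelF F))
    (fun y : F => f (TSmx a 1 y) * ((vabs R (1 + a * y ^+ 2))^-1)%:C%C).

Definition bessel (mu : {sigma_finite_measure set (borelF F) -> \bar R})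
    (nu : {measure set (borelZG F) -> \bar R}) (psi : F -> C) (w t a : F)
    (L : fieldExtType F) (s : L) (Lambda : L -> C) (v : fct) : C :=
  (inner nu w t v v)^-1 *
  TSintegral mu a (fun g =>
    stable_integral mu (fun n =>
      inner nu w t (rtrans (TSembed g *m nmat n) v) v *
      (Lambda (phiS s g))^-1 * (theta psi a n)^-1)).

End Representation.

(* Main.v *)
Require Import Defs.
From HB Require Import structures.
From mathcomp Require Import all_boot all_order all_algebra all_field.
From mathcomp Require Import complex.
From mathcomp Require Import all_classical all_reals all_analysis.
From mathcomp Require Import ring zify.

Set Implicit Arguments.
Unset Strict Implicit.
Unset Printing Implicit Defensive.

Import Order.TTheory GRing.Theory Num.Theory.
Local Open Scope classical_set_scope.
Local Open Scope ring_scope.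

(* The vector v is f_min(x d^-1), so x |-> (g v)(x) conj(v(x)) is the constant
   f_min(d g d^-1) on H' d and vanishes elsewhere; the matrix coefficient is
   therefore f_min(d g d^-1), whatever the Haar measure on Z\G.  For g = t n with
   t = 1 + y sqrt(-a), the lower left block of d g d^-1 vanishes, so that this
   element lies in H' only if it lies in K', i.e. y is in p^(m0-1) and n is in
   u in p^(m0-2), w in p^(-1), z in p^(2 m0-3).  There the choices of alpha and
   beta make chi(d g d^-1) cancel Lambda(t) theta(n), and the integral is the
   volume q^(1-m0) q^(2-m0) q q^(3-2 m0). *)

(** * Valuations and fractional ideals *)

(** The volume of [H'] is never computed: [H' d] has the same volume by right invariance, and this
    volume is positive since [H'] is open and finite since [K'] is compact, so it cancels against
    the normalization. The cancellation also requires [chi] to have absolute value 1, although [psi]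
    is merely a homomorphism to the non-zero complex numbers; this comes from the residual
    characteristic. The sign in chi^+ and chi^- never enters: elements of [g_chi H] have a non-zero
    entry in the lower left block, so only the coset [H] meets the elements [d t n d^-1]. On the
    support the term a z of theta_S is integral, as are all contributions of the factors 1 + p in
    alpha and beta. What remains is the leading term of alpha y, which matches Lambda, and that of
    beta w, which matches theta_S. Every integral thus reduces to that of a function constant on an
    explicit set and zero elsewhere; this is also why the integral over N is stable. *)

Section Valuation.
Variable F : localFieldType.
Implicit Types (x y c : F) (m n : int).

Lemma nval1 : nval (1 : F) = 0.
Proof.
have := nvalM _ _ (oner_neq0 F) (oner_neq0 F); rewrite mulr1 => h.
by apply: (@addrI _ (nval (1 : F))); rewrite addr0.
Qed.

Lemma nvalN1 : nval (-1 : F) = 0.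
Proof.
have N0 : (-1 : F) != 0 by rewrite oppr_eq0 oner_neq0.
by have := nvalM _ _ N0 N0; rewrite mulrNN mulr1 nval1; lia.
Qed.

Lemma nvalV x : x != 0 -> nval x^-1 = - nval x.
Proof.
move=> x0; have := nvalM _ _ x0 (invr_neq0 x0).
by rewrite divff// nval1; lia.
Qed.

Lemma pideal0 n : pideal n (0 : F). Proof. by left. Qed.

Lemma pidealE n x : x != 0 -> pideal n x -> n <= nval x.
Proof. by move=> x0 [/eqP|//]; rewrite (negPf x0). Qed.

Lemma pideal_le m n x : m <= n -> pideal n x -> pideal m x.
Proof. by move=> mn [->|nx]; [left | right; exact: le_trans nx]. Qed.

Lemma pidealM m n x y : pideal m x -> pideal n y -> pideal (m + n) (x * y).
Proof.
move=> [->|mx]; first by rewrite mul0r; left.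
move=> [->|ny]; first by rewrite mulr0; left.
have [->|x0] := eqVneq x 0; first by rewrite mul0r; left.
have [->|y0] := eqVneq y 0; first by rewrite mulr0; left.
by right; rewrite nvalM// lerD.
Qed.

Lemma pideal_mul k m n x y :
  pideal m x -> pideal n y -> k <= m + n -> pideal k (x * y).
Proof. by move=> mx ny kmn; apply: pideal_le kmn _; exact: pidealM. Qed.

Lemma pideal1 : pideal 0 (1 : F). Proof. by right; rewrite nval1. Qed.

Lemma pidealN n x : pideal n x -> pideal n (- x).
Proof.
move=> nx; rewrite -mulN1r -[n]add0r; apply: pidealM => //.
by right; rewrite nvalN1.
Qed.

Lemma pidealD n x y : pideal n x -> pideal n y -> pideal n (x + y).
Proof.
have [->|x0] := eqVneq x 0; first by rewrite add0r.
have [->|y0] := eqVneq y 0; first by rewrite addr0.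
have [->|xy0] := eqVneq (x + y) 0; first by left.
move=> /(pidealE x0) nx /(pidealE y0) ny; right.
by apply: le_trans (nvalD _ _ x0 y0 xy0); rewrite le_min nx.
Qed.

Lemma pidealB n x y : pideal n x -> pideal n y -> pideal n (x - y).
Proof. by move=> nx ny; apply: pidealD => //; exact: pidealN. Qed.

Lemma pideal_sum n (I : Type) (r : seq I) (P : pred I) (f : I -> F) :
  (forall i, P i -> pideal n (f i)) -> pideal n (\sum_(i <- r | P i) f i).
Proof.
move=> nf; elim/big_rec: _ => [|i x Pi]; first exact: pideal0.
by move=> nx; apply: pidealD => //; exact: nf.
Qed.

Lemma pidealMl n c x : c != 0 -> pideal n (c * x) <-> pideal (n - nval c) x.
Proof.
move=> c0; split=> h.
  rewrite -(mulKf c0 x); apply: pideal_mul h _.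
    by right; rewrite nvalV.
  by rewrite addrC.
by apply: pideal_mul h _; [right; exact: lexx | lia].
Qed.

Lemma pideal_nval n x : n = nval x -> pideal n x.
Proof. by move=> ->; right. Qed.

Lemma pideal_eq0 x : (forall n : nat, pideal n%:Z x) -> x = 0.
Proof.
move=> h; apply/eqP/negPn/negP => x0.
by have := pidealE x0 (h `|nval x|.+1%N); lia.
Qed.

Lemma unit1_neq0 x : pideal 1 (x - 1) -> x != 0.
Proof.
move=> h; apply/eqP => x0; move: h; rewrite x0 sub0r.
by move=> /(pidealE _); rewrite oppr_eq0 oner_neq0 nvalN1 => /(_ isT).
Qed.

Lemma nval_unit1 x : pideal 1 (x - 1) -> nval x = 0.
Proof.
move=> h; have x0 := unit1_neq0 h; apply: le_anti; apply/andP; split; last first.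
  apply: pidealE => //; rewrite -(subrK 1 x); apply: pidealD pideal1.
  exact: pideal_le h.
rewrite leNgt; apply/negP => v0.
have : pideal 1 (1 : F).
  by rewrite -(subKr x 1); apply: pidealB h; right.
by move=> /(pidealE (oner_neq0 F)); rewrite nval1.
Qed.

Lemma unit1V x : pideal 1 (x - 1) -> pideal 1 (x^-1 - 1).
Proof.
move=> h; have x0 := unit1_neq0 h.
rewrite (_ : _ - 1 = x^-1 * - (x - 1)); last first.
  by rewrite opprB mulrBr mulVf// mulr1.
apply: pideal_mul (pideal_nval (erefl _)) (pidealN h) _.
by rewrite nvalV// nval_unit1.
Qed.

Lemma unit1M x y : pideal 1 (x - 1) -> pideal 1 (y - 1) -> pideal 1 (x * y - 1).
Proof.
move=> hx hy; rewrite (_ : _ - 1 = x * (y - 1) + (x - 1)); last by ring.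
apply: pidealD => //; apply: pideal_mul (pideal_nval (erefl _)) hy _.
by rewrite nval_unit1.
Qed.

Lemma nvalX x (k : nat) : x != 0 -> nval (x ^+ k) = nval x *+ k.
Proof.
move=> x0; elim: k => [|k IH]; first by rewrite expr0 nval1.
by rewrite exprS nvalM ?expf_neq0// IH mulrS.
Qed.

Lemma nvalXz x n : x != 0 -> nval (x ^ n) = nval x * n.
Proof.
move=> x0; case: n => k.
  by rewrite -exprnP nvalX// -mulr_natr natz.
by rewrite NegzE -exprnN nvalV ?expf_neq0// nvalX// mulrN -mulr_natr natz.
Qed.

Lemma nbhs_pideal x n : nbhs x [set y | pideal n (y - x)].
Proof. by apply/nbhs_nval; exists n. Qed.

Lemma pideal_open c n : open [set x | pideal n (x - c)].
Proof.
rewrite openE => x nx; apply/nbhs_nval; exists n => y ny.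
by rewrite /= -(subrK x y) -addrA; exact: pidealD.
Qed.

Lemma pideal_open0 n : open (@pideal F n).
Proof.
rewrite (_ : pideal n = [set x | pideal n (x - 0)]); first exact: pideal_open.
by apply/seteqP; split => x /=; rewrite subr0.
Qed.

(* An ultrafilter charges exactly one coset of each [p^n], and these cosets
   shrink to a point by completeness. *)
Lemma ultra_limit (T : Type) (U : set_system T) (f : T -> F) (k : int) :
  UltraFilter U -> U (f @^-1` pideal k) ->
  exists2 l, pideal k l & forall n, U [set x | pideal n (f x - l)].
Proof.
move=> UU Uk; have PU : ProperFilter U by exact: ultra_proper.
have [w w0 w1] := @nval_normalized F.
have [rep rep0 repP] := @residue_finite F.
have ex (n : nat) : exists c, U [set x | pideal (k + n%:Z) (f x - c)].
  elim: n => [|n [c Uc]].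
    by exists 0; apply: filterS Uk => x /= h; rewrite !subr0.
  (* The coset of [c] splits into finitely many cosets of the next ideal. If [U] charged none of
     them, it would charge the intersection of their complements, and a point of the coset of [c]
     would lie in no subcoset. *)
  apply: contrapT => /forallNP Nc.
  have : \forall x \near U, forall i : 'I_(resq F),
      ~ pideal (k + n.+1%:Z) (f x - (c + w ^ (k + n%:Z) * rep i)).
    apply: filter_forall => i.
    set A := [set x | pideal (k + n.+1%:Z) (f x - (c + w ^ (k + n%:Z) * rep i))].
    by have [/Nc|//] := in_ultra_setVsetC A UU.
  move=> /(filterI Uc)/filter_ex[x [/= xc]].
  have wn0 : w ^ (k + n%:Z) != 0 by rewrite expfz_neq0.
  have : pideal 0 ((w ^ (k + n%:Z))^-1 * (f x - c)).
    apply: pideal_mul (pideal_nval (erefl _)) xc _.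
    by rewrite nvalV// nvalXz// w1 mul1r addNr.
  move=> /repP[i [hi _]] /(_ i); apply.
  rewrite (_ : _ - _ = w ^ (k + n%:Z) * ((w ^ (k + n%:Z))^-1 * (f x - c) - rep i)).
    apply: pideal_mul (pideal_nval (erefl _)) hi _.
    by rewrite nvalXz// w1 mul1r; lia.
  by rewrite mulrBr mulVKf// opprD addrA.
have [u uP] := choice ex.
have uC (N i j : nat) : (N <= i)%N -> (N <= j)%N ->
    pideal (k + N%:Z) (u i - u j).
  move=> Ni Nj; have [x [/= xi xj]] := filter_ex (filterI (uP i) (uP j)).
  rewrite (_ : _ - _ = (f x - u j) - (f x - u i)); last by ring.
  by apply: pidealB; [apply: pideal_le xj|apply: pideal_le xi]; lia.
have [l ul] : exists l : F, u @ \oo --> l.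
  apply: (nval_complete u) => n; exists `|n - k|%N => i j Ni Nj.
  by apply: pideal_le (uC _ _ _ Ni Nj); lia.
have Ul n : U [set x | pideal n (f x - l)].
  have [N _ hN] : \forall i \near \oo, pideal n (u i - l).
    exact: (ul _ (nbhs_pideal l n)).
  pose i := maxn N `|n - k|%N.
  have := hN i (leq_maxl _ _) => ui.
  apply: filterS (uP i) => x /= xi.
  rewrite (_ : _ - _ = (f x - u i) + (u i - l)); last by ring.
  apply: pidealD => //; apply: pideal_le xi.
  by have := leq_maxr N `|n - k|%N; rewrite -/i; lia.
exists l => //; have [x [/= xk xl]] := filter_ex (filterI Uk (Ul k)).
by rewrite -(subKr (f x) l); exact: pidealB.
Qed.

Lemma pideal_compact n : compact (@pideal F n).
Proof.
rewrite compact_ultra => U UU Un.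
have [l nl Ul] := ultra_limit (f := id) UU Un.
exists l; split=> // A /nbhs_nval[k kA].
by apply: filterS (Ul k) => x; exact: kA.
Qed.

End Valuation.

(** * Haar measure of fractional ideals *)

Section HaarMeasure.
Variables (R : realType) (F : localFieldType).

Lemma resq_gt0 : (0 < resq F)%N.
Proof.
have [rep _ repP] := @residue_finite F.
by have [i _] := repP _ (pideal0 F 0); apply: leq_ltn_trans (ltn_ord i).
Qed.

Lemma measurable_openF (A : set F) : open A -> measurable (A : set (borelF F)).
Proof. by move=> oA; apply: sub_sigma_algebra. Qed.

Lemma measurable_pideal n : measurable (pideal n : set (borelF F)).
Proof. by apply: measurable_openF; exact: pideal_open0. Qed.

Lemma measurable_translate_pideal c n :
  measurable ([set c + y | y in @pideal F n] : set (borelF F)).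
Proof.
apply: measurable_openF.
rewrite (_ : [set _ | _ in _] = [set x | pideal n (x - c)]); first exact: pideal_open.
apply/seteqP; split => [_ [y ny <-]|x /= nx]; first by rewrite /= [c + y]addrC addrK.
by exists (x - c) => //; rewrite addrC subrK.
Qed.

(** The cosets of p^(n+1) in p^n are its translates by [w ^ n * rep i]; translation invariance gives
    all of them the same volume. *)
Lemma haar_pideal_rec (mu : {measure set (borelF F) -> \bar R}) (n : int) :
  is_haarF mu -> mu (pideal n) = ((resq F)%:R%:E * mu (pideal (n + 1)))%E.
Proof.
move=> [mu_tr mu_o].
have [rep rep0 repP] := @residue_finite F.
have [w w0 w1] := @nval_normalized F.
have wn0 : w ^ n != 0 by rewrite expfz_neq0.
have wnn : nval (w ^ n) = n by rewrite nvalXz// w1 mul1r.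
pose A i : set (borelF F) := [set w ^ n * rep i + y | y in @pideal F (n + 1)].
have -> : pideal n = \big[setU/set0]_(i < resq F) A i.
  apply/seteqP; split => [x nx|x].
    have : pideal 0 ((w ^ n)^-1 * x).
      by apply: pideal_mul (pideal_nval (erefl _)) nx _; rewrite nvalV// wnn addNr.
    move=> /repP[i [hi _]]; rewrite -bigcup_seq; exists i; first exact: mem_index_enum.
    exists (w ^ n * ((w ^ n)^-1 * x - rep i)); last by rewrite mulrBr mulVKf// addrC subrK.
    by apply: pideal_mul (pideal_nval (erefl _)) hi _; rewrite wnn.
  rewrite -bigcup_seq => -[i _ [y ny <-]].
  apply: pidealD; last by apply: pideal_le ny; lia.
  by apply: pideal_mul (pideal_nval (erefl _)) (rep0 i) _; rewrite wnn addr0.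
rewrite measure_bigsetU_ord.
- rewrite (eq_bigr (fun=> mu (pideal (n + 1)))) => [|i _]; last first.
    by apply: mu_tr; exact: measurable_pideal.
  by rewrite sumr_const card_ord mule_natl.
- by move=> i; exact: measurable_translate_pideal.
- move=> i j _ _ [x [[y ny <-] [z nz yz]]].
  have ij : pideal 1 (rep i - rep j).
    rewrite (_ : 1 = n + 1 - nval (w ^ n)); last by rewrite wnn; lia.
    apply/(pidealMl _ _ wn0); rewrite mulrBr.
    have -> : w ^ n * rep i - w ^ n * rep j = z - y.
      by rewrite -[z](addKr (w ^ n * rep j)) yz; ring.
    exact: pidealB.
  have [k [_ kU]] := repP _ (rep0 i).
  rewrite -(kU i); last by rewrite subrr; exact: pideal0.
  exact/kU.
Qed.

Lemma haar_pideal (mu : {measure set (borelF F) -> \bar R}) (n : int) :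
  is_haarF mu -> mu (pideal n) = ((resq F)%:R ^ (- n))%:E.
Proof.
move=> hmu; have [_ mu_o] := hmu.
have q0 : (resq F)%:R != 0 :> R by rewrite pnatr_eq0 -lt0n resq_gt0.
have down (m : nat) : mu (pideal m%:Z) = ((resq F)%:R ^- m)%:E.
  elim: m => [|m IH]; first by rewrite mu_o expr0 invr1.
  have := haar_pideal_rec m%:Z hmu; rewrite IH.
  rewrite (_ : m%:Z + 1 = m.+1%:Z); last by lia.
  (* The measure may a priori be infinite; the recursion excludes this because p^m already has
     finite volume. *)
  case: (mu (pideal m.+1%:Z)) => [r| |].
  - by move=> [h]; congr EFin; rewrite exprS invfM h mulKf.
  - by rewrite gt0_muley ?lte_fin ?ltr0n ?resq_gt0.
  - by rewrite gt0_muleNy ?lte_fin ?ltr0n ?resq_gt0.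
have up (m : nat) : mu (pideal (- m%:Z)) = ((resq F)%:R ^+ m)%:E.
  elim: m => [|m IH]; first by rewrite oppr0 mu_o expr0.
  rewrite haar_pideal_rec// (_ : - m.+1%:Z + 1 = - m%:Z); last by lia.
  by rewrite IH -EFinM exprS.
case: n => m; first by rewrite down -exprnN.
by rewrite NegzE up opprK -exprnP.
Qed.

End HaarMeasure.

(** * Symplectic similitudes and the center *)

Section Matrices.
Variable F : localFieldType.
Implicit Types (g h z k A B : 'M[F]_4).

Lemma forall_ord4 (P : 'I_4 -> Prop) : P 0 -> P 1 -> P 2 -> P 3 -> forall i, P i.
Proof.
move=> P0 P1 P2 P3 [[|[|[|[|//]]]] lti].
- by rewrite (_ : Ordinal _ = 0)//; exact: val_inj.
- by rewrite (_ : Ordinal _ = 1)//; exact: val_inj.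
- by rewrite (_ : Ordinal _ = 2)//; exact: val_inj.
- by rewrite (_ : Ordinal _ = 3)//; exact: val_inj.
Qed.

Lemma sum_ord4 (V : nmodType) (f : 'I_4 -> V) :
  \sum_i f i = f 0 + f 1 + f 2 + f 3.
Proof.
rewrite !big_ord_recl big_ord0 addr0 !addrA.
by do !congr (_ + _); congr f; exact: val_inj.
Qed.

Lemma Jmx_sqr : Jmx F *m Jmx F = - 1%:M.
Proof.
apply/matrixP; apply: forall_ord4; apply: forall_ord4;
  rewrite !mxE sum_ord4 !mxE /=; ring.
Qed.

Lemma rev_ord4 : (rev_ord 0 = 3 :> 'I_4) * (rev_ord 1 = 2 :> 'I_4) *
  (rev_ord 2 = 1 :> 'I_4) * (rev_ord 3 = 0 :> 'I_4).
Proof. by do !split; exact: val_inj. Qed.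

Lemma Jmx_conjE A (i j : 'I_4) : (Jmx F *m A *m Jmx F) i j =
  (-1) ^+ ((1 < i)%N (+) (j <= 1)%N) * A (rev_ord i) (rev_ord j).
Proof.
move: i j; apply: forall_ord4; apply: forall_ord4;
  rewrite ?rev_ord4 !mxE sum_ord4 !mxE !sum_ord4 !mxE /=; ring.
Qed.

Lemma Jmx_formE g (i j : 'I_4) : (g^T *m Jmx F *m g) i j =
  g 0 i * g 3 j + g 1 i * g 2 j - g 2 i * g 1 j - g 3 i * g 0 j.
Proof.
have JE (k : 'I_4) : (g^T *m Jmx F) i k = \sum_l g l i * Jmx F l k.
  by rewrite !mxE; apply: eq_bigr => l _; rewrite mxE.
by rewrite mxE sum_ord4 !JE !sum_ord4 !mxE /=; ring.
Qed.

(** Because [Jmx] squares to -1, the form relation itself exhibits the left inverse - mu^-1 J g^T J,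
    so invertibility comes for free. *)
Lemma GSp4_intro g (mu : F) : mu != 0 -> g^T *m Jmx F *m g = mu *: Jmx F -> GSp4 g.
Proof.
move=> mu0 gJ; split; last by exists mu.
have /mulmx1_unit[] // : (- mu^-1 *: (Jmx F *m g^T *m Jmx F)) *m g = 1%:M.
rewrite -scalemxAl -!mulmxA [g^T *m _]mulmxA gJ -scalemxAr scalerA mulNr mulVf//.
by rewrite Jmx_sqr scalerN scaleN1r opprK.
Qed.

Lemma GSp4_unit g : GSp4 g -> g \in unitmx. Proof. by case. Qed.

Lemma GSp4_mul g h : GSp4 g -> GSp4 h -> GSp4 (g *m h).
Proof.
move=> [_ [m m0 gm]] [_ [n n0 hn]]; apply: (GSp4_intro (mu := (m * n))).
  by rewrite mulf_neq0.
rewrite trmx_mul -!mulmxA [Jmx F *m _]mulmxA [g^T *m _]mulmxA [g^T *m (_ *m g)]mulmxA.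
by rewrite gm -scalemxAl -scalemxAr [h^T *m _]mulmxA hn scalerA.
Qed.

Lemma GSp4_inv g : GSp4 g -> GSp4 (invmx g).
Proof.
move=> [gu [m m0 gm]]; apply: (GSp4_intro (mu := m^-1)); first by rewrite invr_neq0.
have : (invmx g)^T *m (g^T *m Jmx F *m g) *m invmx g = (invmx g)^T *m (m *: Jmx F) *m invmx g.
  by rewrite gm.
rewrite -!mulmxA mulmxV// mulmx1 [_ *m (g^T *m _)]mulmxA -trmx_mul mulmxV// trmx1 mul1mx.
by move=> eqJ; rewrite [in RHS]eqJ -scalemxAl -scalemxAr scalerA mulVf// scale1r.
Qed.

Lemma GSp4_scalar (c : F) : c != 0 -> GSp4 c%:M.
Proof.
move=> c0; apply: (GSp4_intro (mu := (c ^+ 2))); first by rewrite expf_neq0.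
by rewrite tr_scalar_mx mul_mx_scalar mul_scalar_mx scalerA expr2.
Qed.

Lemma GSp41 : GSp4 (1%:M : 'M[F]_4).
Proof. by apply: GSp4_scalar; rewrite oner_neq0. Qed.

Lemma GSp4_scale (c : F) g : c != 0 -> GSp4 g -> GSp4 (c *: g).
Proof.
by move=> c0 Gg; rewrite -mul_scalar_mx; apply: GSp4_mul => //; exact: GSp4_scalar.
Qed.

Lemma GSp4_dmx (a b : F) : a != 0 -> b != 0 -> GSp4 (dmx a b).
Proof.
move=> a0 b0; apply: (GSp4_intro (mu := (a ^+ 2 * b))); first by rewrite mulf_neq0 ?expf_neq0.
apply/matrixP; apply: forall_ord4; apply: forall_ord4;
  rewrite Jmx_formE !mxE /=; ring.
Qed.

Lemma GSp4_nmat n : GSp4 (nmat n : 'M[F]_4).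
Proof.
apply: (GSp4_intro (mu := 1)); first exact: oner_neq0.
apply/matrixP; apply: forall_ord4; apply: forall_ord4;
  rewrite Jmx_formE !mxE /=; ring.
Qed.

Lemma GSp4_gchi (w t : F) : w != 0 -> t != 0 -> GSp4 (gchi w t).
Proof.
move=> w0 t0; apply: (GSp4_intro (mu := (- (w / t)))).
  by rewrite oppr_eq0 mulf_neq0 ?invr_neq0.
rewrite /gchi; move: (w / t) => c.
apply/matrixP; apply: forall_ord4; apply: forall_ord4;
  rewrite Jmx_formE !mxE /=; ring.
Qed.

Definition dent (a b : F) (i : 'I_4) : F := [:: a ^+ 2 * b; a * b; a; 1]`_i.

Lemma dmx_diag (a b : F) : dmx a b = diag_mx (\row_i dent a b i).
Proof.
by apply/matrixP; apply: forall_ord4; apply: forall_ord4; rewrite !mxE /= ?mulr1n ?mulr0n.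
Qed.

Lemma dent_neq0 (a b : F) i : a != 0 -> b != 0 -> dent a b i != 0.
Proof.
by move=> a0 b0; move: i; apply: forall_ord4;
  rewrite /dent /= ?mulf_neq0 ?expf_neq0 ?oner_neq0.
Qed.

Lemma invmx_dmx (a b : F) : a != 0 -> b != 0 ->
  invmx (dmx a b) = diag_mx (\row_i (dent a b i)^-1).
Proof.
move=> a0 b0; have du := GSp4_unit (GSp4_dmx a0 b0).
rewrite -[RHS](mulKmx du) dmx_diag mulmx_diag -[LHS]mulmx1; congr (_ *m _).
apply/matrixP => i j; rewrite !mxE; case: eqVneq => // _.
by rewrite divff// dent_neq0.
Qed.

Lemma dmx_conjE (a b : F) g i j : a != 0 -> b != 0 ->
  (dmx a b *m g *m invmx (dmx a b)) i j = dent a b i * g i j / dent a b j.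
Proof.
by move=> a0 b0; rewrite invmx_dmx// dmx_diag mul_diag_mx mul_mx_diag !mxE.
Qed.

(** The torus element [dmx w w] has diagonal entries w^3, w^2, w, 1 of distinct valuations, so
    commuting with it forces [z] to be diagonal. The unipotent element with all coordinates 1 then
    links the four diagonal entries. *)
Lemma ZG_scalar z : ZG z <-> exists2 c : F, c != 0 & z = c%:M.
Proof.
split=> [[Gz zC]|[c c0 ->]]; last first.
  by split=> [|g _]; [exact: GSp4_scalar | rewrite scalar_mxC].
have [w w0 w1] := @nval_normalized F.
have zdiag i j : i != j -> z i j = 0.
  move=> ij; have /matrixP/(_ i j) := zC _ (GSp4_dmx w0 w0).
  rewrite dmx_diag mul_diag_mx mul_mx_diag !mxE => /eqP.
  have dE (k : 'I_4) : dent w w k = w ^+ (3 - k).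
    by move: k; apply: forall_ord4; rewrite /dent /=; ring.
  rewrite mulrC -subr_eq0 -mulrBl mulf_eq0 subr_eq0 => /orP[|/eqP//].
  rewrite !dE => /eqP/(congr1 (@nval F)); rewrite !nvalX// w1 !natz => e.
  by case/eqP: ij; apply/val_inj => /=; move: (ltn_ord i) (ltn_ord j) e; lia.
have zE g i j : (z *m g) i j = z i i * g i j.
  rewrite mxE (bigD1 i)//= big1 ?addr0// => k ki.
  by rewrite zdiag ?mul0r// eq_sym.
have gE g i j : (g *m z) i j = g i j * z j j.
  by rewrite mxE (bigD1 j)//= big1 ?addr0// => k ki; rewrite zdiag ?mulr0.
have zn (i j : 'I_4) : nmat (1, 1, 1 : F) i j = 1 -> z i i = z j j.
  move=> n1; have /matrixP/(_ i j) := zC _ (GSp4_nmat (1, 1, 1)).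
  by rewrite zE gE n1 mulr1 mul1r.
have z0 i : z i i = z 0 0.
  have z03 : z 0 0 = z 3 3 by apply: zn; rewrite !mxE.
  have z02 : z 0 0 = z 2 2 by apply: zn; rewrite !mxE.
  have z12 : z 1 1 = z 2 2 by apply: zn; rewrite !mxE.
  by move: i; apply: forall_ord4; rewrite // z12.
have zM : z = (z 0 0)%:M.
  apply/matrixP => i j; rewrite [RHS]mxE; have [<-|ij] := eqVneq i j.
    by rewrite mulr1n.
  by rewrite mulr0n zdiag.
exists (z 0 0) => //; apply/eqP => z00.
have := GSp4_unit Gz; rewrite zM z00 unitmxE det_scalar expr0n /=.
by rewrite unitr0.
Qed.

End Matrices.

(** * The groups K' and H *)

Section Iwahori.
Variable F : localFieldType.
Implicit Types (g h z k A B : 'M[F]_4).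

Definition iwlevel (i j : 'I_4) : int := if (i < j)%N then 0 else 1.

(** The Jacobson radical of the Iwahori order; [Kprime] consists of the similitudes in 1 +
    [iwrad]. *)
Definition iwrad : set 'M[F]_4 := [set A | forall i j, pideal (iwlevel i j) (A i j)].

Lemma iwradD A B : iwrad A -> iwrad B -> iwrad (A + B).
Proof. by move=> rA rB i j; rewrite mxE; apply: pidealD. Qed.

Lemma iwradN A : iwrad A -> iwrad (- A).
Proof. by move=> rA i j; rewrite mxE; apply: pidealN. Qed.

Lemma iwradZ (c : F) A : pideal 0 c -> iwrad A -> iwrad (c *: A).
Proof. by move=> c0 rA i j; rewrite mxE -[iwlevel i j]add0r; apply: pidealM. Qed.

Lemma iwrad_scalar (c : F) : pideal 1 c -> iwrad c%:M.
Proof.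
move=> c1 i j; rewrite mxE /iwlevel; have [->|_] := eqVneq i j.
  by rewrite mulr1n ltnn.
exact: pideal0.
Qed.

Lemma iwlevel_add (i j l : 'I_4) : iwlevel i j <= iwlevel i l + iwlevel l j.
Proof. by rewrite /iwlevel; do 3!case: ifP; lia. Qed.

Lemma iwradM A B : iwrad A -> iwrad B -> iwrad (A *m B).
Proof.
move=> rA rB i j; rewrite mxE; apply: pideal_sum => k _.
exact: pideal_mul (rA i k) (rB k j) (iwlevel_add i j k).
Qed.

Lemma KprimeE k : Kprime k <-> GSp4 k /\ iwrad (k - 1%:M).
Proof.
split=> -[Gk kr]; split=> // i j; have := kr i j; rewrite !mxE /iwlevel.
  by case: eqVneq => [->|ij]; rewrite ?ltnn// subr0; case: ifP.
by case: eqVneq => [->|ij]; rewrite ?ltnn// subr0; case: ifP.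
Qed.

Lemma Kprime1 : Kprime (1%:M : 'M[F]_4).
Proof.
apply/KprimeE; split; first exact: GSp41.
by rewrite subrr => i j; rewrite mxE; exact: pideal0.
Qed.

Lemma Kprime_mul k h : Kprime k -> Kprime h -> Kprime (k *m h).
Proof.
move=> /KprimeE[Gk rk] /KprimeE[Gh rh]; apply/KprimeE; split; first exact: GSp4_mul.
rewrite (_ : _ - _ = (k - 1%:M) *m (h - 1%:M) + (k - 1%:M) + (h - 1%:M)).
  by do 2!apply: iwradD => //; exact: iwradM.
by rewrite mulmxBr mulmx1 subrK mulmxBl mul1mx addrA subrK.
Qed.

(** Up to signs, [A] is reflected in the antidiagonal, which preserves the positions above the
    diagonal. *)
Lemma iwrad_conj A : iwrad A -> iwrad (Jmx F *m A^T *m Jmx F).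
Proof.
move=> rA i j; rewrite Jmx_conjE mxE -[iwlevel i j]add0r; apply: pidealM.
  case: (_ (+) _); last exact: pideal1.
  by rewrite expr1; apply: pidealN; exact: pideal1.
rewrite (_ : iwlevel i j = iwlevel (rev_ord j) (rev_ord i)); first exact: rA.
rewrite /iwlevel /=; have := ltn_ord i; have := ltn_ord j => hj hi.
by rewrite (_ : (4 - j.+1 < 4 - i.+1)%N = (i < j)%N)//; lia.
Qed.

Lemma Kprime_diag k i : Kprime k -> pideal 1 (k i i - 1).
Proof. by move=> [_ /(_ i i)]; rewrite eqxx. Qed.

Lemma Kprime_up k i j : Kprime k -> pideal 0 (k i j).
Proof.
move=> Kk; have [<-|ij] := eqVneq i j.
  rewrite -(subrK 1 (k i i)); apply: pidealD (pideal1 F).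
  exact: pideal_le (Kprime_diag i Kk).
case: Kk => _ /(_ i j); rewrite (negPf ij); case: ifP => // _.
exact: pideal_le.
Qed.

Lemma Kprime_low k (i j : 'I_4) : (j < i)%N -> Kprime k -> pideal 1 (k i j).
Proof.
move=> ij [_ /(_ i j)]; case: eqVneq ij => [->|_ ij]; first by rewrite ltnn.
by rewrite ltnNge ltnW.
Qed.

Lemma Kprime_similitude k (m : F) :
  Kprime k -> k^T *m Jmx F *m k = m *: Jmx F -> pideal 1 (m - 1).
Proof.
move=> Kk /matrixP/(_ 0 3); rewrite Jmx_formE !mxE /= mulr1 => <-.
have lo (i j i' j' : 'I_4) : (j < i)%N -> pideal 1 (k i j * k i' j').
  by move=> ij; apply: pideal_mul (Kprime_low ij Kk) (Kprime_up _ _ Kk) _.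
rewrite (_ : _ - 1 = (k 0 0 * k 3 3 - 1) + k 1 0 * k 2 3 - k 2 0 * k 1 3 -
  k 3 0 * k 0 3); last by ring.
apply: pidealB; last exact: lo.
apply: pidealB; last exact: lo.
apply: pidealD; last exact: lo.
by apply: unit1M; exact: Kprime_diag.
Qed.

(** The similitude relation expresses the inverse as - m^-1 J k^T J, which reduces the claim to
    stability of [iwrad] under antidiagonal reflection and to [m] lying in 1 + p. *)
Lemma Kprime_inv k : Kprime k -> Kprime (invmx k).
Proof.
move=> Kk; have /KprimeE[Gk rk] := Kk; apply/KprimeE; split; first exact: GSp4_inv.
have [ku [m m0 km]] := Gk; have m1 := Kprime_similitude Kk km.
have -> : invmx k = - m^-1 *: (Jmx F *m k^T *m Jmx F).
  rewrite -[RHS]mulmx1 -(mulmxV ku) mulmxA -scalemxAl -!mulmxA [k^T *m _]mulmxA km.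
  by rewrite -scalemxAr scalerA mulNr mulVf// Jmx_sqr scalerN scaleN1r opprK mul1mx.
have -> : Jmx F *m k^T *m Jmx F = Jmx F *m (k - 1%:M)^T *m Jmx F - 1%:M.
  by rewrite linearB /= trmx1 mulmxBr mulmxBl mulmx1 Jmx_sqr opprK addrK.
rewrite scalerBr scaleNr [X in _ - X - _]scaleNr opprK -addrA; apply: iwradD.
  apply: iwradN; apply: iwradZ; last exact: iwrad_conj.
  by apply: pideal_nval; rewrite nvalV// nval_unit1// oppr0.
rewrite scalemx1 (_ : _ - _ = (m^-1 - 1)%:M); last by rewrite raddfB.
by apply: iwrad_scalar; exact: unit1V.
Qed.

Lemma HgrpE h : Hgrp h <-> exists (c : F) k, [/\ c != 0, Kprime k & h = c *: k].
Proof.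
split=> [[z [k [/ZG_scalar[c c0 ->] Kk ->]]]|[c [k [c0 Kk ->]]]].
  by exists c, k; rewrite mul_scalar_mx.
by exists c%:M, k; rewrite mul_scalar_mx; split=> //; apply/ZG_scalar; exists c.
Qed.

Lemma Hgrp_mul g h : Hgrp g -> Hgrp h -> Hgrp (g *m h).
Proof.
move=> /HgrpE[c [k [c0 Kk ->]]] /HgrpE[d [l [d0 Kl ->]]].
apply/HgrpE; exists (c * d), (k *m l); split; rewrite ?mulf_neq0//.
  exact: Kprime_mul.
by rewrite -scalemxAl -scalemxAr scalerA.
Qed.

Lemma Hgrp_inv g : Hgrp g -> Hgrp (invmx g).
Proof.
move=> /HgrpE[c [k [c0 Kk ->]]]; apply/HgrpE; exists c^-1, (invmx k).
have ku : k \in unitmx by apply: GSp4_unit; case: Kk.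
split; [by rewrite invr_neq0 | exact: Kprime_inv |].
by rewrite invmxZ// unitmxZ// unitfE.
Qed.

Lemma Kprime_Hgrp k : Kprime k -> Hgrp k.
Proof. by move=> Kk; apply/HgrpE; exists 1, k; rewrite oner_neq0 scale1r. Qed.

Lemma Hgrp_scale (c : F) h : c != 0 -> Hgrp h -> Hgrp (c *: h).
Proof.
move=> c0 /HgrpE[d [k [d0 Kk ->]]]; apply/HgrpE; exists (c * d), k.
by rewrite scalerA mulf_neq0.
Qed.

Lemma Hgrp_GSp4 h : Hgrp h -> GSp4 h.
Proof.
by move=> /HgrpE[c [k [c0 [Gk _] ->]]]; exact: GSp4_scale.
Qed.

End Iwahori.

(** * The minimal vector *)

Section MinimalCharacter.
Variables (R : realType) (F : localFieldType).
Variables (psi : F -> R[i]) (w t : F).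
Hypotheses (psi_char : add_character psi)
  (psi_o : forall x, ointegers x -> psi x = 1).
Hypotheses (w_unif : uniformizer w) (t_unit : ounits t).
Implicit Types (g h k A B : 'M[F]_4) (x y c : F).

Let w0 : w != 0. Proof. by case: w_unif. Qed.
Let w1 : nval w = 1. Proof. by case: w_unif. Qed.
Let t0 : t != 0. Proof. by case: t_unit. Qed.
Let tv0 : nval t = 0. Proof. by case: t_unit. Qed.

Lemma psiD x y : psi (x + y) = psi x * psi y.
Proof. by case: psi_char. Qed.

Lemma psi_neq0 x : psi x != 0.
Proof. by case: psi_char. Qed.

Lemma psi_congr x y : pideal 0 (x - y) -> psi x = psi y.
Proof. by move=> xy; rewrite -(subrK y x) psiD psi_o// mul1r. Qed.

Lemma psi_w_congr x y : pideal 1 (x - y) -> psi (w^-1 * x) = psi (w^-1 * y).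
Proof.
move=> xy; apply: psi_congr; rewrite -mulrBr.
by apply: pideal_mul (pideal_nval (erefl _)) xy _; rewrite nvalV// w1.
Qed.

Let G := gchi w t.
Let Gu : G \in unitmx. Proof. exact/GSp4_unit/GSp4_gchi. Qed.

Lemma gchi_sqr : G *m G = - (w / t) *: 1%:M.
Proof.
rewrite /G /gchi; move: (w / t) => c.
by apply/matrixP; apply: forall_ord4; apply: forall_ord4;
  rewrite !mxE sum_ord4 !mxE /=; ring.
Qed.

Lemma gchi_conj A : invmx G *m A *m G =
  let c := w / t in mxrows 4 4
  [:: [:: A 2 2; - A 2 3; - (A 2 0 / c); A 2 1 / c];
      [:: - A 3 2; A 3 3; A 3 0 / c; - (A 3 1 / c)];
      [:: - (c * A 0 2); c * A 0 3; A 0 0; - A 0 1];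
      [:: c * A 1 2; - (c * A 1 3); - A 1 0; A 1 1]].
Proof.
rewrite -mulmxA; apply: (canLR (mulKmx Gu)).
have : w / t != 0 by rewrite mulf_neq0 ?invr_neq0.
rewrite /G /gchi; move: (w / t) => c c0.
by apply/matrixP; apply: forall_ord4; apply: forall_ord4;
  rewrite !mxE !sum_ord4 !mxE /=; field.
Qed.

Lemma gchi_conj_iwrad A : iwrad A -> iwrad (invmx G *m A *m G).
Proof.
move=> rA; rewrite gchi_conj => i j; rewrite mxE.
have c0 : w / t != 0 by rewrite mulf_neq0 ?invr_neq0.
have cM (n : int) x : pideal n x -> pideal (n + 1) (w / t * x).
  move=> nx; apply: pideal_mul (pideal_nval (erefl _)) nx _.
  by rewrite nvalM ?invr_neq0// nvalV// w1 tv0; lia.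
have cV (n : int) x : pideal n x -> pideal (n - 1) (x / (w / t)).
  move=> nx; rewrite mulrC; apply: pideal_mul (pideal_nval (erefl _)) nx _.
  by rewrite nvalV// nvalM ?invr_neq0// nvalV// w1 tv0; lia.
move: i j; apply: forall_ord4; apply: forall_ord4 => /=;
  do ?apply: pidealN; first
  [ exact: (rA _ _)
  | by apply: (pideal_le _ (cM _ _ (rA _ _)))
  | by apply: (pideal_le _ (cV _ _ (rA _ _))) ].
Qed.

Lemma gchi_conj_Kprime k : Kprime k -> Kprime (invmx G *m k *m G).
Proof.
move=> /KprimeE[Gk rk]; apply/KprimeE; split.
  apply: GSp4_mul; last exact: GSp4_gchi.
  by apply: GSp4_mul => //; apply: GSp4_inv; exact: GSp4_gchi.
by have := gchi_conj_iwrad rk; rewrite mulmxBr mulmxBl mulmx1 mulVmx.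
Qed.

(** The linear form under the additive character in [chi], taken on all matrices so that it applies
    to differences such as [k - 1%:M]. *)
Definition minlevel A : F := A 0 1 + A 1 2 + t * w^-1 * A 3 0.

Lemma minlevelD A B : minlevel (A + B) = minlevel A + minlevel B.
Proof. by rewrite /minlevel !mxE; ring. Qed.

Lemma minlevelZ c A : minlevel (c *: A) = c * minlevel A.
Proof. by rewrite /minlevel !mxE; ring. Qed.

Lemma minlevel1 : minlevel 1%:M = 0.
Proof. by rewrite /minlevel !mxE /= !mulr0n mulr0 !addr0. Qed.

Let tw n x : pideal (n + 1) x -> pideal n (t * w^-1 * x).
Proof.
move=> nx; apply: pideal_mul (pideal_nval (erefl _)) nx _.
by rewrite nvalM ?invr_neq0// nvalV// w1 tv0; lia.
Qed.

(** A product of two elements of the radical gains one power of p at the positions (0, 1) and (1,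
    2), and lies in p^2 at (3, 0), where w^-1 takes one power back. *)
Lemma minlevelM A B : iwrad A -> iwrad B -> pideal 1 (minlevel (A *m B)).
Proof.
move=> rA rB; have rAB i j l : pideal (iwlevel i l + iwlevel l j) (A i l * B l j).
  by apply: pidealM.
rewrite /minlevel !mxE; apply: pidealD; last first.
  by apply: tw; apply: pideal_sum; apply: forall_ord4 => _;
    apply: (pideal_le _ (rAB _ _ _)).
by apply: pidealD; apply: pideal_sum; apply: forall_ord4 => _;
  apply: (pideal_le _ (rAB _ _ _)).
Qed.

Lemma minlevel_o k : Kprime k -> pideal 0 (minlevel k).
Proof.
move=> Kk; rewrite /minlevel; apply: pidealD; first by apply: pidealD; exact: Kprime_up.
by apply: tw; exact: Kprime_low.
Qed.

Lemma minlevel_small A : (forall i j, pideal 2 (A i j)) -> pideal 1 (minlevel A).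
Proof.
by move=> A2; apply: pidealD; [apply: pidealD; exact: pideal_le (A2 _ _) | exact: tw].
Qed.

(** Write kh = (k - 1)(h - 1) + k + h - 1: the form vanishes at 1, and the first term is negligible.
    This is why [chi] is multiplicative. *)
Lemma minlevel_Kprime_mul k h : Kprime k -> Kprime h ->
  pideal 1 (minlevel (k *m h) - (minlevel k + minlevel h)).
Proof.
move=> /KprimeE[_ rk] /KprimeE[_ rh].
rewrite (_ : _ - _ = minlevel ((k - 1%:M) *m (h - 1%:M))); first exact: minlevelM.
have -> : k *m h = (k - 1%:M) *m (h - 1%:M) + (k + h + -1 *: 1%:M).
  rewrite mulmxBr mulmx1 mulmxBl mul1mx scaleN1r opprB.
  by rewrite [_ + (1%:M - k)]addrC; apply/matrixP => i j; rewrite !mxE; ring.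
by rewrite !minlevelD minlevelZ minlevel1 mulr0 addr0 addrK.
Qed.

Lemma minlevel_gchi_conj k : Kprime k ->
  pideal 1 (minlevel (invmx G *m k *m G) - minlevel k).
Proof.
move=> Kk; have [[_ [m m0 /matrixP km]] _] := Kk.
(* The (1, 3) entry of the similitude relation gives [k 2 3 = - k 0 1] mod p. *)
move: (km 1 3).
rewrite Jmx_formE !mxE /= mulr0 => {}km.
rewrite gchi_conj /minlevel !mxE /=.
rewrite (_ : _ - _ = k 0 1 * (k 3 3 - 1) + (k 1 1 - 1) * k 2 3 - k 2 1 * k 1 3 -
  k 3 1 * k 0 3).
  have d i := Kprime_diag i Kk; have u i j := Kprime_up i j Kk.
  by do ![apply: pidealB|apply: pidealD]; first
   [ by apply: pideal_mul (u _ _) (d _) _ | by apply: pideal_mul (d _) (u _ _) _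
   | by apply: pideal_mul (Kprime_low _ Kk) (u _ _) _ ].
by rewrite -[LHS]addr0 -km; field; rewrite w0 t0.
Qed.

(** This is the well-definedness of [chi]: two decompositions of an element of [H] differ by a
    scalar in 1 + p, which changes the integral number [minlevel k] only modulo p. *)
Lemma chi_scale c k : c != 0 -> Kprime k ->
  chi psi w t (c *: k) = psi (w^-1 * minlevel k).
Proof.
move=> c0 Kk; apply: xget_unique.
  exists c%:M, k; split=> //; last by rewrite mul_scalar_mx.
  by apply/ZG_scalar; exists c.
move=> _ [z [l [/ZG_scalar[d d0 ->] Kl + ->]]]; rewrite mul_scalar_mx => kl.
have {}kl : k = (c^-1 * d) *: l by rewrite -scalerA -kl scalerA mulVf// scale1r.
have l1 := Kprime_diag 0 Kl; move: (c^-1 * d) kl => e kl.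
have e1 : pideal 1 (e - 1).
  have := Kprime_diag 0 Kk; rewrite kl mxE => el.
  rewrite -(mulfK (unit1_neq0 l1) e); apply: unit1M => //; exact: unit1V.
apply: psi_w_congr; rewrite kl minlevelZ -/(minlevel l) -{1}[minlevel l]mul1r -mulrBl.
rewrite -opprB mulNr; apply: pidealN.
exact: pideal_mul e1 (minlevel_o Kl) _.
Qed.

Lemma chi_mul g h : Hgrp g -> Hgrp h ->
  chi psi w t (g *m h) = chi psi w t g * chi psi w t h.
Proof.
move=> /HgrpE[c [k [c0 Kk ->]]] /HgrpE[d [l [d0 Kl ->]]].
rewrite -scalemxAl -scalemxAr scalerA !chi_scale ?mulf_neq0//; last exact: Kprime_mul.
rewrite -psiD -mulrDr; apply: psi_w_congr; exact: minlevel_Kprime_mul.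
Qed.

Lemma chi_scaleH c h : c != 0 -> Hgrp h -> chi psi w t (c *: h) = chi psi w t h.
Proof.
move=> c0 /HgrpE[d [l [d0 Kl ->]]].
by rewrite scalerA !chi_scale// mulf_neq0.
Qed.

Lemma Hgrp_gchi_conj h : Hgrp h -> Hgrp (invmx G *m h *m G).
Proof.
move=> /HgrpE[d [l [d0 Kl ->]]]; rewrite -scalemxAr -scalemxAl; apply: Hgrp_scale => //.
by apply: Kprime_Hgrp; exact: gchi_conj_Kprime.
Qed.

Lemma chi_gchi_conj h : Hgrp h -> chi psi w t (invmx G *m h *m G) = chi psi w t h.
Proof.
move=> /HgrpE[d [l [d0 Kl ->]]]; rewrite -scalemxAr -scalemxAl !chi_scale//.
  by apply: psi_w_congr; exact: minlevel_gchi_conj.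
exact: gchi_conj_Kprime.
Qed.

(** Otherwise [gchi] itself would lie in [H], but its entry (0, 0) is zero. The two cosets forming
    [H'] are therefore disjoint. *)
Lemma gchiN_Hgrp h : Hgrp h -> ~ Hgrp (G *m h).
Proof.
move=> Hh HGh; have : Hgrp (G *m h *m invmx h) by apply: Hgrp_mul => //; exact: Hgrp_inv.
rewrite mulmxK; last exact/GSp4_unit/Hgrp_GSp4.
move=> /HgrpE[c [k [c0 Kk /matrixP/(_ 0 0)]]]; rewrite !mxE /= => /esym/eqP.
by rewrite mulf_eq0 (negPf c0) (negPf (unit1_neq0 (Kprime_diag 0 Kk))).
Qed.

Lemma HprimeP h : Hprime w t h <-> Hgrp h \/ exists2 h', Hgrp h' & h = G *m h'.
Proof. by split=> -[Hh|[h' Hh' e]]; by [left | right; exists h']. Qed.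

Lemma Hgrp_Hprime h : Hgrp h -> Hprime w t h. Proof. by left. Qed.

Lemma Hprime_GSp4 h : Hprime w t h -> GSp4 h.
Proof.
move=> /HprimeP[|[h' Hh' ->]]; first exact: Hgrp_GSp4.
by apply: GSp4_mul; [exact: GSp4_gchi | exact: Hgrp_GSp4].
Qed.

Let gchi_swap h : h *m G = G *m (invmx G *m h *m G).
Proof. by rewrite -mulmxA mulKVmx. Qed.

Let gchi_gchi g h : (G *m g) *m (G *m h) = - (w / t) *: ((invmx G *m g *m G) *m h).
Proof.
rewrite mulmxA -[G *m g *m G]mulmxA gchi_swap mulmxA gchi_sqr.
by rewrite -!scalemxAl mul1mx.
Qed.

Let wtN0 : - (w / t) != 0.
Proof. by rewrite oppr_eq0 mulf_neq0 ?invr_neq0. Qed.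

Lemma Hprime_mul g h : Hprime w t g -> Hprime w t h -> Hprime w t (g *m h).
Proof.
move=> /HprimeP[Hg|[g' Hg' ->]] /HprimeP[Hh|[h' Hh' ->]]; apply/HprimeP.
- by left; exact: Hgrp_mul.
- right; exists ((invmx G *m g *m G) *m h'); last by rewrite mulmxA gchi_swap !mulmxA.
  by apply: Hgrp_mul => //; exact: Hgrp_gchi_conj.
- by right; exists (g' *m h); [exact: Hgrp_mul | rewrite mulmxA].
- left; rewrite gchi_gchi; apply: Hgrp_scale => //.
  by apply: Hgrp_mul => //; exact: Hgrp_gchi_conj.
Qed.

Lemma Hprime_inv g : Hprime w t g -> Hprime w t (invmx g).
Proof.
move=> /HprimeP[Hg|[h Hh ->]]; first by left; exact: Hgrp_inv.
have hu := GSp4_unit (Hgrp_GSp4 Hh).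
apply/HprimeP; right; exists ((- (w / t))^-1 *: (invmx G *m invmx h *m G)).
  apply: Hgrp_scale; first by rewrite invr_neq0.
  by apply: Hgrp_gchi_conj; exact: Hgrp_inv.
have GhX : (G *m h) *m (G *m ((- (w / t))^-1 *: (invmx G *m invmx h *m G))) = 1%:M.
  rewrite -scalemxAr -gchi_swap -scalemxAr mulmxA mulmxK// gchi_sqr scalerA.
  by rewrite mulVf// scale1r.
have [Ghu _] := mulmx1_unit GhX.
by rewrite -[LHS]mulmx1 -GhX mulKmx.
Qed.

Lemma chi_pmE eps h : Hgrp h -> chi_pm eps psi w t h = chi psi w t h.
Proof. by move=> Hh; rewrite /chi_pm ifT// inE. Qed.

Lemma chi_pm_gchi eps h : Hgrp h ->
  chi_pm eps psi w t (G *m h) = (-1) ^+ eps * chi psi w t h.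
Proof.
move=> Hh; rewrite /chi_pm ifF; last by apply/negbTE; rewrite notin_setE; exact: gchiN_Hgrp.
by rewrite mulKmx.
Qed.

(** The sign rule is consistent because conjugation by [G] preserves [chi] and the square of [G] is
    the scalar - (w / t), on which [chi] is trivial; two signs multiply to 1. *)
Lemma chi_pm_mul eps g h : Hprime w t g -> Hprime w t h ->
  chi_pm eps psi w t (g *m h) = chi_pm eps psi w t g * chi_pm eps psi w t h.
Proof.
move=> /HprimeP[Hg|[g' Hg' ->]] /HprimeP[Hh|[h' Hh' ->]].
- by rewrite !chi_pmE ?chi_mul//; exact: Hgrp_mul.
- rewrite mulmxA gchi_swap -[_ *m h']mulmxA.
  have Hc := Hgrp_gchi_conj Hg.
  rewrite chi_pm_gchi; last exact: Hgrp_mul.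
  by rewrite chi_mul// chi_gchi_conj// chi_pmE// chi_pm_gchi//; ring.
- rewrite -mulmxA chi_pm_gchi; last exact: Hgrp_mul.
  by rewrite chi_mul// (chi_pmE _ Hh) chi_pm_gchi// mulrA.
- have Hc := Hgrp_gchi_conj Hg'; rewrite gchi_gchi chi_pmE; last first.
    by apply: Hgrp_scale => //; exact: Hgrp_mul.
  rewrite chi_scaleH//; last exact: Hgrp_mul.
  rewrite chi_mul// chi_gchi_conj// !chi_pm_gchi// mulrACA -expr2 sqrr_sign mul1r.
  by [].
Qed.

Lemma fmin_Hprime eps h : Hprime w t h ->
  fmin eps psi w t h = chi_pm eps psi w t h.
Proof. by move=> Hh; rewrite /fmin ifT// inE. Qed.

Lemma fmin_eq0 eps h : ~ Hprime w t h -> fmin eps psi w t h = 0.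
Proof. by move=> Hh; rewrite /fmin ifF//; apply/negbTE; rewrite notin_setE. Qed.

Lemma fmin_mull eps h g : Hprime w t h ->
  fmin eps psi w t (h *m g) = chi_pm eps psi w t h * fmin eps psi w t g.
Proof.
move=> Hh; have [Hg|Hg] := pselect (Hprime w t g).
  by rewrite !fmin_Hprime ?chi_pm_mul//; exact: Hprime_mul.
rewrite !fmin_eq0 ?mulr0// => Hhg; apply: Hg.
rewrite -(mulKmx (GSp4_unit (Hprime_GSp4 Hh)) g).
by apply: Hprime_mul => //; exact: Hprime_inv.
Qed.

Lemma fmin_mulr eps h g : Hprime w t h ->
  fmin eps psi w t (g *m h) = fmin eps psi w t g * chi_pm eps psi w t h.
Proof.
move=> Hh; have [Hg|Hg] := pselect (Hprime w t g).
  by rewrite !fmin_Hprime ?chi_pm_mul//; exact: Hprime_mul.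
rewrite !fmin_eq0 ?mul0r// => Hhg; apply: Hg.
rewrite -(mulmxK (GSp4_unit (Hprime_GSp4 Hh)) g).
by apply: Hprime_mul => //; exact: Hprime_inv.
Qed.

Lemma chi_pm_Kprime eps k : Kprime k ->
  chi_pm eps psi w t k = psi (w^-1 * minlevel k).
Proof.
move=> Kk; rewrite chi_pmE; last exact: Kprime_Hgrp.
by rewrite -[k in LHS]scale1r chi_scale// oner_neq0.
Qed.

Lemma fmin1 eps : fmin eps psi w t 1%:M = 1.
Proof.
have H1 := Kprime1 F.
rewrite fmin_Hprime; last exact/Hgrp_Hprime/Kprime_Hgrp.
by rewrite chi_pm_Kprime// minlevel1 mulr0 psi_o//; exact: pideal0.
Qed.

(** Since p x is integral, [psi x] is a p-th root of unity. The values of [chi] only involve [psi]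
    on p^(-1). *)
Lemma norm_psi (p : nat) x : residual_char F p -> pideal (-1) x -> `|psi x| = 1.
Proof.
move=> [p_prime p1] x1.
have psiMn n : psi (x *+ n) = psi x ^+ n.
  elim: n => [|n IH]; first by rewrite mulr0n expr0 psi_o//; exact: pideal0.
  by rewrite mulrS psiD IH exprS.
have : psi (x *+ p) = 1.
  by rewrite -mulr_natl; apply: psi_o; apply: pideal_mul p1 x1 _.
rewrite psiMn => /(congr1 Num.norm); rewrite normrX normr1 => /eqP.
by rewrite pexprn_eq1 ?prime_gt0// => /orP[/eqP p0|/eqP//]; rewrite p0 in p_prime.
Qed.

Lemma norm_chi_pm eps (p : nat) h : residual_char F p -> Hprime w t h ->
  `|chi_pm eps psi w t h| = 1.
Proof.
move=> hp; have nchi g : Hgrp g -> `|chi psi w t g| = 1.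
  move=> /HgrpE[c [k [c0 Kk ->]]]; rewrite chi_scale//.
  apply: (norm_psi hp); apply: pideal_mul (pideal_nval (erefl _)) (minlevel_o Kk) _.
  by rewrite nvalV// w1.
move=> /HprimeP[Hh|[g Hg ->]]; first by rewrite chi_pmE// nchi.
by rewrite chi_pm_gchi// normrM normr_sign mul1r nchi.
Qed.

End MinimalCharacter.

(** * Topology of matrices *)

(** The integrals over Z\G, over N and over the torus are all evaluated in this form. Real and
    imaginary parts are treated together, as maps [g] with [g 0 = 0]. *)
Lemma cintegral_cst_on d (T : measurableType d) (R : realType)
    (mu : {measure set T -> \bar R}) (D A : set T) (f : T -> R[i]) (c : R[i]) :
  measurable A -> A `<=` D -> (forall x, A x -> f x = c) ->
  (forall x, ~ A x -> f x = 0) ->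
  cintegral mu D f = (fine (mu A))%:C%C * c.
Proof.
move=> mA AD fA f0.
have int (g : R[i] -> R) : g 0 = 0 ->
    Rintegral mu D (fun x => g (f x)) = g c * fine (mu A).
  move=> g0; rewrite Rintegral_mkcond -(Rintegral_cst mu mA) [RHS]Rintegral_mkcond.
  apply: eq_Rintegral => x _; rewrite /patch.
  have [Ax|Ax] := pselect (A x).
    by rewrite !ifT ?inE//; [rewrite fA | exact: AD].
  by rewrite [in RHS]ifF ?f0 ?g0 ?if_same//; apply/negbTE; rewrite notin_setE.
rewrite /cintegral !int//; case: c {fA int} => a b /=.
by apply/eqP; rewrite eq_complex /= !mul0r subr0 addr0 ![fine _ * _]mulrC !eqxx.
Qed.

Section MatrixTopology.
Variable F : localFieldType.
Implicit Types (g h k x y A B : 'M[F]_4) (n : int).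

Definition mxideal n : set 'M[F]_4 := [set A | forall i j, pideal n (A i j)].

Lemma mxideal_le m n A : m <= n -> mxideal n A -> mxideal m A.
Proof. by move=> mn nA i j; exact: pideal_le (nA i j). Qed.

Lemma mxidealD n A B : mxideal n A -> mxideal n B -> mxideal n (A + B).
Proof. by move=> nA nB i j; rewrite mxE; exact: pidealD. Qed.

Lemma mxidealN n A : mxideal n A -> mxideal n (- A).
Proof. by move=> nA i j; rewrite mxE; exact: pidealN. Qed.

Lemma mxidealM m n A B : mxideal m A -> mxideal n B -> mxideal (m + n) (A *m B).
Proof.
by move=> mA nB i j; rewrite mxE; apply: pideal_sum => k _; exact: pidealM.
Qed.

Lemma mxideal_tr n A : mxideal n A -> mxideal n A^T.
Proof. by move=> nA i j; rewrite mxE. Qed.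

Lemma mxideal_iwrad A : mxideal 1 A -> iwrad A.
Proof. by move=> A1 i j; apply: pideal_le (A1 i j); rewrite /iwlevel; case: ifP. Qed.

Lemma mxideal_ex A : exists n, mxideal n A.
Proof.
exists (- (\max_(p : 'I_4 * 'I_4) `|nval (A p.1 p.2)|%N)%:Z) => i j; right.
have := @leq_bigmax _ (fun p : 'I_4 * 'I_4 => `|nval (A p.1 p.2)|%N) (i, j) => /=.
by lia.
Qed.

(** The denominators of [d] and of its inverse cost a fixed number of powers of p. *)
Lemma mxideal_conj d (n : int) : d \in unitmx ->
  exists m, forall k, mxideal m (k - 1%:M) -> mxideal n (d *m k *m invmx d - 1%:M).
Proof.
move=> du; have [a da] := mxideal_ex d; have [b db] := mxideal_ex (invmx d).
exists (n - a - b) => k mk.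
rewrite (_ : _ - _ = d *m (k - 1%:M) *m invmx d); last first.
  by rewrite mulmxBr mulmx1 mulmxBl mulmxV.
by apply: mxideal_le (mxidealM (mxidealM da mk) db); lia.
Qed.

Lemma nbhs_mxideal x n : nbhs x [set y | mxideal n (y - x)].
Proof.
exists (fun i j => [set z | pideal n (z - x i j)]) => [i j|y /= xy i j].
  exact: nbhs_pideal.
by rewrite !mxE; exact: xy.
Qed.

Lemma mxideal_nbhs x (A : set 'M[F]_4) n :
  (forall y, mxideal n (y - x) -> A y) -> nbhs x A.
Proof. by move=> nA; apply: filterS (nbhs_mxideal x n). Qed.

(** Near a point x d of the translate, a similitude has the form x (d k d^-1) d with k close to 1,
    hence d k d^-1 in [Kprime], and [W] absorbs this factor. *)
Lemma openZG_translate (W : set 'M[F]_4) d : GSp4 d -> W `<=` GSp4 ->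
  (forall c x, c != 0 -> W x -> W (c *: x)) ->
  (forall x k, W x -> Kprime k -> W (x *m k)) ->
  openZG [set x *m d | x in W].
Proof.
move=> Gd WG WZ WK; have du := GSp4_unit Gd; split; last first.
  move=> z _ /ZG_scalar[c c0 ->] [x Wx <-].
  by exists (c *: x); [exact: WZ | rewrite mul_scalar_mx scalemxAl].
have WdG : [set x *m d | x in W] `<=` GSp4.
  by move=> _ [x Wx <-]; apply: GSp4_mul => //; exact: WG.
(* The ambient open set is the union of all balls whose similitudes lie in the translate. Allowing
   any centre makes it open at once, balls being ultrametric. *)
pose V := [set y | exists x n, (forall z, mxideal n (z - x) -> GSp4 z ->
  [set x *m d | x in W] z) /\ mxideal n (y - x)].
exists V.
  rewrite openE => y [x [n [xW yx]]]; apply: (@mxideal_nbhs _ _ n) => z zy.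
  exists x, n; split=> //; rewrite -(subrK y z) -addrA; exact: mxidealD.
apply/seteqP; split=> [y yW|y [[x [n [xW yx]]] Gy]]; last exact: xW.
split; last exact: WdG.
have Gy := WdG _ yW; have yu := GSp4_unit Gy.
have [m mP] := mxideal_conj 1 du; have [a ya] := mxideal_ex (invmx y).
exists y, (m - a); split; last by rewrite subrr => i j; rewrite mxE; exact: pideal0.
move=> z zy Gz; case: yW => x Wx xy.
pose k := invmx y *m z.
have mk : mxideal m (k - 1%:M).
  by rewrite -(mulVmx yu) -mulmxBr; apply: mxideal_le (mxidealM ya zy); lia.
have Gk : GSp4 k by apply: GSp4_mul => //; exact: GSp4_inv.
exists (x *m (d *m k *m invmx d)).
  apply: WK => //; apply/KprimeE; split; last exact/mxideal_iwrad/mP.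
  by apply: GSp4_mul; [exact: GSp4_mul | exact: GSp4_inv].
by rewrite -!mulmxA mulVmx// mulmx1 mulmxA xy /k mulKVmx.
Qed.

Lemma Jmx_mxideal : mxideal 0 (Jmx F).
Proof.
have N1 : pideal 0 (-1 : F) by apply: pidealN; exact: pideal1.
have I0 := pideal0 F 0; have I1 := pideal1 F.
by apply: forall_ord4; apply: forall_ord4; rewrite mxE.
Qed.

(** An ultrafilter on [Kprime] converges entrywise. The limit stays in [Kprime] because it is
    congruent to elements of [Kprime] modulo every power of p, and the form relation passes to such
    limits. *)
Lemma Kprime_compact : compact (@Kprime F).
Proof.
rewrite compact_ultra => U UU UK; have PU : ProperFilter U by exact: ultra_proper.
have lex (p : 'I_4 * 'I_4) : exists l : F, forall n, U [set k | pideal n (k p.1 p.2 - l)].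
  have Up : U ((fun k : 'M[F]_4 => k p.1 p.2) @^-1` pideal 0).
    by apply: filterS UK => k Kk; exact: Kprime_up.
  by have [l _ lU] := ultra_limit UU Up; exists l.
have [f fU] := choice lex; pose l : 'M[F]_4 := \matrix_(i, j) f (i, j).
have Ul n : U [set k | mxideal n (k - l)].
  have UA : U [set k | forall p, pideal n (k p.1 p.2 - f p)].
    exact: filter_forall _ (fun p => fU p n).
  by apply: filterS UA => k /= kf i j; rewrite !mxE; exact: (kf (i, j)).
exists l; split; last first.
  move=> A [P lP PA].
  have UP p : U [set k : 'M[F]_4 | P p.1 p.2 (k p.1 p.2)].
    case: p => i j /=.
    have /nbhs_nval[n nP] := lP i j; apply: filterS (Ul n) => k kl.
    by apply: nP; have := kl i j; rewrite !mxE.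
  have UA : U [set k | forall p, P p.1 p.2 (k p.1 p.2)] by exact: filter_forall.
  by apply: filterS UA => k kP; apply: PA => i j; exact: (kP (i, j)).
have lK n : exists2 k, Kprime k & mxideal n (l - k).
  have [k [Kk kl]] := filter_ex (filterI UK (Ul n)); exists k => //.
  by rewrite -opprB; exact: mxidealN.
have Jcongr n k : Kprime k -> mxideal n (l - k) -> 0 <= n ->
    mxideal n (l^T *m Jmx F *m l - k^T *m Jmx F *m k).
  move=> Kk kl n0; have k0 : mxideal 0 k by move=> i j; exact: Kprime_up.
  set e := l - k; rewrite -/e in kl; have -> : l = k + e by rewrite addrC subrK.
  rewrite (_ : _ - _ = (k + e)^T *m Jmx F *m e + e^T *m Jmx F *m k).
    have J0 := Jmx_mxideal; have e0 := mxideal_le n0 kl.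
    have ke0 := mxidealD k0 e0.
    apply: mxidealD.
      by apply: mxideal_le (mxidealM (mxidealM (mxideal_tr ke0) J0) kl); rewrite add0r.
    by apply: mxideal_le (mxidealM (mxidealM (mxideal_tr kl) J0) k0); rewrite !addr0.
  rewrite [(k + e)^T]linearD /= mulmxDr !mulmxDl; set a := k^T *m _ *m k.
  by apply/matrixP => i j; rewrite !mxE; ring.
(* The similitude factor of the limit can only be its form at the entry (0, 3), where [Jmx] is 1. *)
pose m := (l^T *m Jmx F *m l) 0 3.
have m1 : pideal 1 (m - 1).
  have [k Kk kl] := lK 1; have [[_ [mk mk0 kJ]] _] := Kk.
  rewrite (_ : m - 1 = (l^T *m Jmx F *m l - k^T *m Jmx F *m k) 0 3 + (mk - 1)).
    by apply: pidealD; [exact: Jcongr | exact: Kprime_similitude kJ].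
  by rewrite kJ /m !mxE /=; ring.
apply/KprimeE; split; last first.
  have [k /KprimeE[_ rk] kl] := lK 1.
  rewrite -(subrK k l) -addrA; apply: iwradD => //; exact: mxideal_iwrad.
apply: (@GSp4_intro _ _ m); first exact: unit1_neq0.
apply/matrixP => i j; apply/eqP; rewrite -subr_eq0; apply/eqP/pideal_eq0 => n.
have [k Kk kl] := lK n%:Z; have [[_ [mk mk0 kJ]] _] := Kk.
have lJ := Jcongr _ _ Kk kl isT.
(* The unknown factor [mk] of the approximating [k] cancels between the entries (i, j) and (0,
   3). *)
have -> : (l^T *m Jmx F *m l) i j - (m *: Jmx F) i j =
  (l^T *m Jmx F *m l - k^T *m Jmx F *m k) i j -
  (l^T *m Jmx F *m l - k^T *m Jmx F *m k) 0 3 * Jmx F i j.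
  by rewrite kJ /m !mxE /=; ring.
apply: pidealB; first exact: lJ.
by rewrite -[n%:Z]addr0; apply: pidealM; [exact: lJ | exact: Jmx_mxideal].
Qed.

End MatrixTopology.

(** * Matrix coefficients *)

Section InducedRepresentation.
Variables (R : realType) (F : localFieldType).
Variables (psi : F -> R[i]) (w t : F) (eps : bool) (p : nat).
Hypotheses (psi_char : add_character psi)
  (psi_o : forall x, ointegers x -> psi x = 1).
Hypotheses (w_unif : uniformizer w) (t_unit : ounits t) (hp : residual_char F p).
Implicit Types (g h k d : 'M[F]_4).

Let w0 : w != 0. Proof. by case: w_unif. Qed.
Let w1 : nval w = 1. Proof. by case: w_unif. Qed.
Let t0 : t != 0. Proof. by case: t_unit. Qed.

Let Hprime1 : Hprime w t 1%:M.
Proof. exact/Hgrp_Hprime/Kprime_Hgrp/Kprime1. Qed.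

Lemma Hprime_scale (c : F) h : c != 0 -> Hprime w t h -> Hprime w t (c *: h).
Proof.
move=> c0 Hh; rewrite -[h]mul1mx scalemxAl; apply: Hprime_mul => //.
by apply/Hgrp_Hprime/Hgrp_scale => //; exact/Kprime_Hgrp/Kprime1.
Qed.

Lemma Hprime_translate_openZG d : GSp4 d -> openZG [set x *m d | x in Hprime w t].
Proof.
move=> Gd; apply: openZG_translate => //.
- exact: Hprime_GSp4.
- exact: Hprime_scale.
- by move=> x k Hx Kk; apply: Hprime_mul => //; exact/Hgrp_Hprime/Kprime_Hgrp.
Qed.

Lemma Hgrp_translate_openZG d : GSp4 d -> openZG [set x *m d | x in @Hgrp F].
Proof.
move=> Gd; apply: openZG_translate => //.
- exact: Hgrp_GSp4.
- by move=> c x; exact: Hgrp_scale.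
- by move=> x k Hx Kk; apply: Hgrp_mul => //; exact/Kprime_Hgrp.
Qed.

Let translate1 (W : set 'M[F]_4) : [set x *m 1%:M | x in W] = W.
Proof.
apply/seteqP; split=> [_ [x Wx <-]|x Wx]; first by rewrite mulmx1.
by exists x => //; rewrite mulmx1.
Qed.

Lemma Hprime_openZG : openZG (Hprime w t).
Proof. by rewrite -[Hprime w t]translate1; exact/Hprime_translate_openZG/GSp41. Qed.

Lemma Hgrp_openZG : openZG (@Hgrp F).
Proof. by rewrite -[Hgrp]translate1; exact/Hgrp_translate_openZG/GSp41. Qed.

Lemma measurable_openZG (U : set 'M[F]_4) :
  openZG U -> measurable (U : set (borelZG F)).
Proof. by move=> oU; apply: sub_sigma_algebra. Qed.

(** The Haar measure is invariant under right translations, so the left coset has to be seen inside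
    a right one. As [G] has scalar square, conjugation by [G] and by its inverse agree, and both
    preserve [H]. *)
Lemma gchiH_Hgrp : gchiH w t `<=` [set h *m gchi w t | h in Hgrp].
Proof.
have Gu : gchi w t \in unitmx by exact/GSp4_unit/GSp4_gchi.
move=> _ [h Hh <-]; set G := gchi w t.
have Hc := Hgrp_gchi_conj w_unif t_unit Hh.
have GV : G = - (w / t) *: invmx G.
  by rewrite -[LHS]mulmx1 -(mulmxV Gu) mulmxA gchi_sqr// -scalemxAl mul1mx.
exists (G *m h *m invmx G); last by rewrite mulmxKV.
have -> : G *m h *m invmx G = invmx G *m h *m G.
  by rewrite {1 4}GV -!scalemxAl -scalemxAr.
exact: Hc.
Qed.

(** * Volume of [H'] and matrix coefficients of translated minimal vectors *)

Section HaarZG.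
Variable nu : {measure set (borelZG F) -> \bar R}.
Hypothesis hnu : is_haarZG nu.

Lemma nu_Hprime_gt0 : (0 < nu (Hprime w t))%E.
Proof.
have [_ _ nu0] := hnu; apply: nu0; first exact: Hprime_openZG.
by exists 1%:M.
Qed.

(** [H] is Z times the compact [Kprime], and [H'] is covered by [H] and one right translate of
    it. *)
Lemma nu_Hprime_lty : (nu (Hprime w t) < +oo)%E.
Proof.
have [nu_tr nu_c _] := hnu.
have nuH : (nu (@Hgrp F) < +oo)%E.
  by apply: nu_c; [exact: Kprime_compact | move=> k []].
have GG : GSp4 (gchi w t) by exact: GSp4_gchi.
have mH := measurable_openZG Hgrp_openZG.
have mHG := measurable_openZG (Hgrp_translate_openZG GG).
apply: (@le_lt_trans _ _ (nu Hgrp + nu ([set h *m gchi w t | h in @Hgrp F] : set 'M[F]_4))%E).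
  apply: (le_trans _ (measureU2 nu mH mHG)).
  apply: le_measure; rewrite ?inE.
  - by apply: measurable_openZG; exact: Hprime_openZG.
  - exact: measurableU.
  - by apply: setUS; exact: gchiH_Hgrp.
rewrite (nu_tr _ _ GG mH); last exact: Hgrp_GSp4.
by rewrite lte_add_pinfty.
Qed.

(* The integrand is [f (d g d^-1)] times the indicator of [H' d]. *)
Lemma inner_fmin d g : GSp4 d ->
  let v := rtrans (invmx d) (fmin eps psi w t) in
  inner nu w t (rtrans g v) v = fmin eps psi w t (d *m g *m invmx d).
Proof.
move=> Gd v; have du := GSp4_unit Gd; have [nu_tr _ _] := hnu.
have mH : measurable (Hprime w t : set (borelZG F)).
  by apply: measurable_openZG; exact: Hprime_openZG.
pose A : set (borelZG F) := [set x *m d | x in Hprime w t].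
have mA : measurable A by apply: measurable_openZG; exact: Hprime_translate_openZG.
have nuA : nu A = nu (Hprime w t) by apply: nu_tr => //; exact: Hprime_GSp4.
rewrite /inner (@cintegral_cst_on _ _ _ nu _ A _ (fmin eps psi w t (d *m g *m invmx d)))//.
- rewrite nuA mulrA -rmorphM /= mulVf ?mul1r// gt_eqF// fine_gt0//.
  by rewrite nu_Hprime_gt0 nu_Hprime_lty.
- by move=> _ [x Hx <-]; apply: GSp4_mul => //; exact: Hprime_GSp4 Hx.
(* At x = h d the integrand is chi(h) f(d g d^-1) times the conjugate of chi(h), and chi(h) has
   absolute value 1. *)
- move=> _ [h Hh <-]; rewrite /v /rtrans mulmxK// -!mulmxA fmin_mull//.
  rewrite [fmin _ _ _ _ h]fmin_Hprime// [_ * fmin _ _ _ _ _]mulrC -mulrA -normCK.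
  by rewrite (norm_chi_pm psi_char psi_o w_unif t_unit eps hp Hh) expr1n mulr1 mulmxA.
- move=> x xA; rewrite [v x]fmin_eq0 ?conjC0 ?mulr0// => Hx; apply: xA.
  by exists (x *m invmx d) => //; rewrite mulmxKV.
Qed.

End HaarZG.

Lemma fmin_translate_cInd d : GSp4 d ->
  cInd eps psi w t (rtrans (invmx d) (fmin eps psi w t)).
Proof.
move=> Gd; have du := GSp4_unit Gd; split.
- by move=> h g Hh Gg; rewrite /rtrans -mulmxA fmin_mull.
(* Level 2 is needed: [chi] is trivial on matrices congruent to 1 modulo p^2, one power being lost
   to the coefficient t w^-1 of the entry (3, 0) and one to the factor w^-1 under [psi]. *)
- have [m mP] := mxideal_conj 2 du.
  exists [set k | mxideal m (k - 1%:M)]; first exact: nbhs_mxideal.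
  move=> k g /mP kd Gk Gg; rewrite /rtrans.
  have -> : g *m k *m invmx d = (g *m invmx d) *m (d *m k *m invmx d).
    by rewrite !mulmxA mulmxKV.
  have Kd : Kprime (d *m k *m invmx d).
    apply/KprimeE; split; last by apply/mxideal_iwrad/(mxideal_le _ kd).
    by apply: GSp4_mul; [exact: GSp4_mul | exact: GSp4_inv].
  rewrite fmin_mulr//; last exact/Hgrp_Hprime/Kprime_Hgrp.
  rewrite chi_pm_Kprime// (_ : psi _ = 1) ?mulr1//; apply: psi_o.
  rewrite -(subrK 1%:M (d *m k *m invmx d)) minlevelD minlevel1 addr0.
  apply: pideal_mul (pideal_nval (erefl _)) (_ : pideal 1 _) _.
    exact: minlevel_small.
  by rewrite nvalV// w1.
- exists [set d]; split; [exact: compact_set1 | by move=> _ -> |].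
  move=> g Gg gv; exists (g *m invmx d), d; split=> //; last by rewrite mulmxKV.
  by apply: contrapT => Hg; rewrite /rtrans fmin_eq0// eqxx in gv.
Qed.

End InducedRepresentation.

(** * Stable integrals over N *)

Lemma open_setX (T U : topologicalType) (A : set T) (B : set U) :
  open A -> open B -> open (A `*` B).
Proof.
move=> oA oB; rewrite openE => -[x y] [/= Ax By].
by exists (A, B) => //=; split; exact: open_nbhs_nbhs.
Qed.

Section UnipotentIntegral.
Variables (R : realType) (F : localFieldType).
Implicit Types (n : F * F * F) (i j k : int).

Definition boxN i j k : set (F * F * F) := (pideal i `*` pideal j) `*` pideal k.

Lemma boxN_le i j k i' j' k' : i' <= i -> j' <= j -> k' <= k ->
  boxN i j k `<=` boxN i' j' k'.
Proof.
move=> ii jj kk n [[ni nj] nk].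
by split; [split|]; [exact: pideal_le ni | exact: pideal_le nj | exact: pideal_le nk].
Qed.

Lemma nmat_mul m n :
  nmat m *m nmat n = nmat (m.1.1 + n.1.1, m.1.2 + n.1.2, m.2 + n.2).
Proof.
by apply/matrixP; apply: forall_ord4; apply: forall_ord4;
  rewrite !mxE sum_ord4 !mxE /=; ring.
Qed.

Lemma nmat0 : nmat (0, 0, 0) = 1%:M :> 'M[F]_4.
Proof.
by apply/matrixP; apply: forall_ord4; apply: forall_ord4; rewrite !mxE.
Qed.

Lemma nmat_inv n : invmx (nmat n) = nmat (- n.1.1, - n.1.2, - n.2).
Proof.
rewrite -[LHS]mulmx1 -nmat0.
have -> : nmat (0, 0, 0) = nmat n *m nmat (- n.1.1, - n.1.2, - n.2).
  by rewrite nmat_mul /= !subrr.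
by rewrite mulKmx// (GSp4_unit (GSp4_nmat n)).
Qed.

Lemma boxN_subgroup i j k : compact_open_subgroupN (boxN i j k).
Proof.
split.
- by do ?apply: compact_setX; exact: pideal_compact.
- by do ?apply: open_setX; exact: pideal_open0.
- exists (0, 0, 0); last exact: nmat0.
  by split; [split|]; exact: pideal0.
- move=> m n [[mi mj] mk] [[ni nj] nk]; rewrite nmat_mul.
  by eexists; last reflexivity; split; [split|]; exact: pidealD.
- move=> n [[ni nj] nk]; rewrite nmat_inv.
  by eexists; last reflexivity; split; [split|]; exact: pidealN.
Qed.

(** The open boxes increase with [m] and exhaust N, so compactness yields a single one. *)
Lemma compact_boxN (U : set (F * F * F)) : compact U ->
  exists m : nat, U `<=` boxN (- m%:Z) (- m%:Z) (- m%:Z).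
Proof.
move=> /compact_near_coveringP cU.
have [] := cU nat \oo (fun m n => boxN (- m%:Z) (- m%:Z) (- m%:Z) n).
  move=> [[x y] z] _.
  pose M := (`|nval x| + `|nval y| + `|nval z|)%N.
  exists (boxN (- M%:Z) (- M%:Z) (- M%:Z), [set m | (M <= m)%N]); last first.
    move=> [n m] [/= nM Mm]; apply: boxN_le nM; lia.
  split; last by exists M.
  apply: open_nbhs_nbhs; split.
    by do ?apply: open_setX; exact: pideal_open0.
  by split; [split|]; right => /=; rewrite /M; lia.
by move=> M _ hM; exists M; apply: (hM M); rewrite /=.
Qed.

Lemma measurable_boxN i j k :
  measurable (boxN i j k : set (borelF F * borelF F * borelF F)).
Proof. by do ?apply: measurableX; exact: measurable_pideal. Qed.

Section HaarN.
Variable mu : {sigma_finite_measure set (borelF F) -> \bar R}.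
Hypothesis hmu : is_haarF mu.

Lemma haar_boxN i j k :
  ((mu \x mu) \x mu)%E (boxN i j k : set (borelF F * borelF F * borelF F)) =
  ((resq F)%:R ^ (- (i + j + k)))%:E.
Proof.
have q0 : (resq F)%:R != 0 :> R by rewrite pnatr_eq0 -lt0n resq_gt0.
have mp := @measurable_pideal F.
pose A : set (borelF F * borelF F) :=
  (pideal i : set (borelF F)) `*` (pideal j : set (borelF F)).
have mA : measurable A by exact: measurableX.
transitivity (((mu \x mu) A) * mu (pideal k))%E; first exact: product_measure1E.
rewrite /A product_measure1E// !haar_pideal// -!EFinM.
by congr EFin; rewrite -!expfzDr// !opprD.
Qed.

(** Any compact open subgroup containing the box contains the support of [f], so the box itself can
    serve as the threshold group. *)
Lemma stable_integral_boxN (f : F * F * F -> R[i]) (c : R[i]) i j k :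
  (forall n, boxN i j k n -> f n = c) -> (forall n, ~ boxN i j k n -> f n = 0) ->
  stable_integral mu f = ((resq F)%:R ^ (- (i + j + k)))%:C%C * c.
Proof.
move=> fc f0.
have int (U : set (F * F * F)) : boxN i j k `<=` U ->
    cintegral ((mu \x mu) \x mu)%E (U : set (borelF F * borelF F * borelF F)) f =
    ((resq F)%:R ^ (- (i + j + k)))%:C%C * c.
  move=> BU.
  rewrite (@cintegral_cst_on _ _ _ _ _ _ _ c (measurable_boxN i j k) BU)//.
  by congr (_%:C%C * _); exact: (congr1 fine (haar_boxN i j k)).
apply: xget_unique.
  by exists (boxN i j k); [exact: boxN_subgroup | move=> U _ /int].
move=> c' [U [cU _ _ _ _] Uc].
have [m Um] := compact_boxN cU.
(* A competing value [c'] comes with its own threshold group [U]. A box containing both [U] and the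
   support of [f] computes both values. *)
pose M := (- (m%:Z + `|i| + `|j| + `|k|))%R.
rewrite -(Uc (boxN M M M)) ?int//; first by apply: boxN_le; rewrite /M; lia.
- exact: boxN_subgroup.
- by apply: (subset_trans Um); apply: boxN_le; rewrite /M; lia.
Qed.

End HaarN.
End UnipotentIntegral.

(** * The elements d t n d^-1 *)

Section BesselData.
Variable F : localFieldType.
Implicit Types (a x y c : F) (n : F * F * F) (h X : 'M[F]_4).

Lemma TSmx_det a y : \det (TSmx a 1 y) = 1 + a * y ^+ 2.
Proof.
by rewrite (expand_det_row _ 0) !big_ord_recl big_ord0 /cofactor !det_mx11 !mxE /=; ring.
Qed.

(** The factor det g turns the inverse of g into its adjugate, so no denominator is left. *)
Lemma TSembed_TSmx a y : 1 + a * y ^+ 2 != 0 ->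
  TSembed (TSmx a 1 y) = mxrows 4 4
    [:: [:: 1; y; 0; 0]; [:: - (a * y); 1; 0; 0];
        [:: 0; 0; 1; - y]; [:: 0; 0; a * y; 1]].
Proof.
move=> D0; have gu : TSmx a 1 y \in unitmx by rewrite unitmxE TSmx_det unitfE.
have gV : invmx (TSmx a 1 y) = (1 + a * y ^+ 2)^-1 *:
    mxrows 2 2 [:: [:: 1; - y]; [:: a * y; 1]].
  rewrite -[LHS]mulmx1; apply: (canLR (mulKmx gu)); rewrite -scalemxAr.
  apply: (canRL (scalerK _)) => //.
  apply/matrixP => -[[|[|//]] ?] [[|[|//]] ?];
    rewrite !mxE !big_ord_recl big_ord0 !mxE /=; ring.
rewrite /TSembed gV TSmx_det linearZ /= -scalemxAr -scalemxAl scalerA divff// scale1r.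
rewrite -[RHS](@submxK _ 2 2 2 2); apply: (f_equal4 (@block_mx F 2 2 2 2));
  apply/matrixP => -[[|[|//]] ?] [[|[|//]] ?];
  rewrite !mxE /= ?big_ord_recl ?big_ord0 ?mxE /= ?big_ord_recl ?big_ord0 ?mxE /=; ring.
Qed.

Lemma GSp4_TSembed a y : 1 + a * y ^+ 2 != 0 -> GSp4 (TSembed (TSmx a 1 y)).
Proof.
move=> D0; rewrite TSembed_TSmx//; apply: (GSp4_intro D0).
apply/matrixP; apply: forall_ord4; apply: forall_ord4; rewrite Jmx_formE !mxE /=; ring.
Qed.

Lemma TSembed_nmat a y n : 1 + a * y ^+ 2 != 0 ->
  TSembed (TSmx a 1 y) *m nmat n =
  let u := n.1.1 in let w := n.1.2 in let z := n.2 in mxrows 4 4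
    [:: [:: 1; y; u + y * w; z + y * u];
        [:: - (a * y); 1; w - a * y * u; u - a * y * z];
        [:: 0; 0; 1; - y]; [:: 0; 0; a * y; 1]].
Proof.
move=> D0; rewrite TSembed_TSmx//.
by apply/matrixP; apply: forall_ord4; apply: forall_ord4;
  rewrite !mxE sum_ord4 !mxE /=; ring.
Qed.

(** Elements of [g_chi H] have the non-zero entry - (w / t) c [k 0 0] at (2, 0), which excludes that
    coset. The entry 1 at (2, 2) then forces the central factor into 1 + p. *)
Lemma Hprime_Kprime (w t : F) X : w != 0 -> t != 0 ->
  Hprime w t X -> X 2 0 = 0 -> X 2 2 = 1 -> Kprime X.
Proof.
move=> w0 t0 /HprimeP[|[h /HgrpE[c [k [c0 Kk ->]]] ->]]; last first.
  rewrite mxE sum_ord4 !mxE /= !mul0r !addr0 => /eqP.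
  rewrite mulf_eq0 oppr_eq0 mulf_eq0 invr_eq0 (negPf w0) (negPf t0) /=.
  by rewrite mulf_eq0 (negPf c0) (negPf (unit1_neq0 (Kprime_diag 0 Kk))).
move=> /HgrpE[c [k [c0 Kk ->]]] _; rewrite mxE => ck.
have k1 := Kprime_diag 2 Kk.
have c1 : pideal 1 (c - 1).
  rewrite (_ : c = (k 2 2)^-1); first exact: unit1V.
  by rewrite -(mulfK (unit1_neq0 k1) c) ck mul1r.
have /KprimeE[Gk rk] := Kk; apply/KprimeE; split; first exact: GSp4_scale.
rewrite (_ : _ - _ = c *: (k - 1%:M) + (c - 1)%:M).
  apply: iwradD; last exact: iwrad_scalar.
  by apply: iwradZ => //; apply: pideal_nval; rewrite nval_unit1.
by rewrite scalerBr scalemx1 raddfB /= addrA subrK.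
Qed.

(** The cross term y u lies in p^((m0 - 1) + (m0 - 2)), which is exactly the ideal allowed for z. *)
Lemma support_zu (m0 : nat) y n : (2 <= m0)%N -> pideal (m0%:Z - 1) y ->
  boxN (m0%:Z - 2) (-1) (2 * m0%:Z - 3) n ->
  pideal (2 * m0%:Z - 3) (n.2 + y * n.1.1).
Proof.
move=> m0_ge2 yP [[uP _] zP]; apply: pidealD => //; apply: pideal_mul yP uP _; lia.
Qed.

Lemma support_wu (m0 : nat) a y n : (2 <= m0)%N -> pideal 0 a ->
  pideal (m0%:Z - 1) y -> boxN (m0%:Z - 2) (-1) (2 * m0%:Z - 3) n ->
  pideal (-1) (n.1.2 - a * y * n.1.1).
Proof.
move=> m0_ge2 a_int yP [[uP wP] _]; apply: pidealB => //.
by apply: pideal_mul (pidealM a_int yP) uP _; lia.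
Qed.

(** * Support of the matrix coefficient on torus elements times N *)

Section Support.
Variables (a alpha beta y : F) (n : F * F * F) (m0 : nat).
Hypotheses (m0_ge2 : (2 <= m0)%N) (a_int : pideal 0 a).
Hypotheses (alpha0 : alpha != 0) (valpha : nval alpha = 1 - m0%:Z).
Hypotheses (beta0 : beta != 0) (vbeta : nval beta = 1).
Hypothesis (D0 : 1 + a * y ^+ 2 != 0).

Let d := dmx alpha beta.
Let X := d *m (TSembed (TSmx a 1 y) *m nmat n) *m invmx d.
(** The exponents are the negatives of the valuations of alpha beta, beta and alpha^2 beta, the
    factors by which conjugation by [d] scales u, w and z. *)
Let B : set (F * F * F) := boxN (m0%:Z - 2) (-1) (2 * m0%:Z - 3).

Lemma dmx_conj_TSembed_nmat : X =
  let u := n.1.1 in let w := n.1.2 in let z := n.2 in mxrows 4 4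
    [:: [:: 1; alpha * y; alpha * beta * (u + y * w); alpha ^+ 2 * beta * (z + y * u)];
        [:: - (a * y / alpha); 1; beta * (w - a * y * u); alpha * beta * (u - a * y * z)];
        [:: 0; 0; 1; - (alpha * y)]; [:: 0; 0; a * y / alpha; 1]].
Proof.
apply/matrixP => i j; rewrite /X dmx_conjE// TSembed_nmat// !mxE /dent.
by move: i j; apply: forall_ord4; apply: forall_ord4 => /=; field;
  rewrite ?alpha0 ?beta0 ?oner_neq0.
Qed.

Let GX : GSp4 X.
Proof.
have Gd : GSp4 d by exact: GSp4_dmx.
apply: GSp4_mul; last exact: GSp4_inv.
apply: GSp4_mul => //; apply: GSp4_mul; [exact: GSp4_TSembed | exact: GSp4_nmat].
Qed.

Let vab : nval (alpha * beta) = 2 - m0%:Z.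
Proof. by rewrite nvalM// valpha vbeta; lia. Qed.

Let vaab : nval (alpha ^+ 2 * beta) = 3 - 2 * m0%:Z.
Proof. by rewrite nvalM ?expf_neq0// nvalX// valpha vbeta; lia. Qed.

Let ab0 : alpha * beta != 0. Proof. by rewrite mulf_neq0. Qed.
Let aab0 : alpha ^+ 2 * beta != 0. Proof. by rewrite mulf_neq0 ?expf_neq0. Qed.

Lemma Hprime_support (w t : F) : w != 0 -> t != 0 ->
  Hprime w t X -> pideal (m0%:Z - 1) y /\ B n.
Proof.
move=> w0 t0 HX; have KX : Kprime X.
  by apply: (Hprime_Kprime w0 t0 HX); rewrite dmx_conj_TSembed_nmat !mxE.
have scale (c x : F) k : c != 0 -> k = - nval c -> pideal 0 (c * x) -> pideal k x.
  by move=> c0 -> /(pidealMl _ _ c0); rewrite sub0r.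
have up i j := Kprime_up i j KX.
have := (up 0 1, up 0 2, up 0 3, up 1 2, up 1 3).
rewrite dmx_conj_TSembed_nmat !mxE /= => -[[[[X01 X02] X03] X12] X13].
have yP : pideal (m0%:Z - 1) y by apply: scale X01 => //; rewrite valpha; lia.
have zu : pideal (2 * m0%:Z - 3) (n.2 + y * n.1.1).
  by apply: scale X03 => //; rewrite vaab; lia.
have wu : pideal (-1) (n.1.2 - a * y * n.1.1) by apply: scale X12 => //; rewrite vbeta.
have uz : pideal (m0%:Z - 2) (n.1.1 - a * y * n.2).
  by apply: scale X13 => //; rewrite vab; lia.
have ay : pideal (m0%:Z - 1) (a * y) by apply: pideal_mul a_int yP _; lia.
have ay2 : pideal 1 (1 + a * y ^+ 2 - 1).
  rewrite addrAC subrr add0r expr2 mulrA; apply: pideal_mul ay yP _; lia.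
have uP : pideal (m0%:Z - 2) n.1.1.
  (* The entries (0, 3) and (1, 3) only control z + y u and u - a y z. This linear system in u and z
     has determinant 1 + a y^2, a unit in 1 + p because [m0_ge2] puts y in p. *)
  rewrite (_ : n.1.1 = (1 + a * y ^+ 2)^-1 *
    ((n.1.1 - a * y * n.2) + a * y * (n.2 + y * n.1.1))).
    apply: pideal_mul (pideal_nval (erefl _)) (_ : pideal (m0%:Z - 2) _) _.
      by apply: pidealD => //; apply: pideal_mul ay zu _; lia.
    by rewrite nvalV// nval_unit1// oppr0 add0r.
  by field.
split=> //; split; [split=> //|] => /=.
  rewrite -(subrK (a * y * n.1.1) n.1.2); apply: pidealD => //.
  by apply: pideal_mul ay uP _; lia.
rewrite -(addrK (y * n.1.1) n.2); apply: pidealB => //.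
by apply: pideal_mul yP uP _; lia.
Qed.

(** All cross terms are absorbed by the ideals of the box. The tight ones are y w, of exponent (m0 -
    1) - 1 as for u, and y u, of the exponent of z. *)
Lemma support_Kprime : pideal (m0%:Z - 1) y -> B n -> Kprime X.
Proof.
move=> yP nB; have [[uP wP] zP] := nB.
have zu := support_zu m0_ge2 yP nB; have wu := support_wu m0_ge2 a_int yP nB.
have ay : pideal (m0%:Z - 1) (a * y) by apply: pideal_mul a_int yP _; lia.
have uw : pideal (m0%:Z - 2) (n.1.1 + y * n.1.2).
  by apply: pidealD => //; apply: pideal_mul yP wP _; lia.
have uz : pideal (m0%:Z - 2) (n.1.1 - a * y * n.2).
  by apply: pidealB => //; apply: pideal_mul ay zP _; lia.
have mulP (c x : F) k : pideal k x -> k = - nval c -> pideal 0 (c * x).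
  by move=> kx kc; apply: pideal_mul (pideal_nval (erefl _)) kx _; rewrite kc addrN.
have Xay : pideal 1 (a * y / alpha).
  by apply: pideal_mul ay (pideal_nval (erefl _)) _; rewrite nvalV// valpha; lia.
have Xy : pideal 0 (alpha * y) by apply: mulP yP _; rewrite valpha; lia.
apply/KprimeE; split; first exact: GX.
rewrite dmx_conj_TSembed_nmat.
apply: forall_ord4; apply: forall_ord4; rewrite !mxE /iwlevel /= ?subrr ?subr0.
1,6,11,16: exact: pideal0.
- exact: Xy.
- by apply: mulP uw _; rewrite vab; lia.
- by apply: mulP zu _; rewrite vaab; lia.
- exact: pidealN.
- by apply: mulP wu _; rewrite vbeta; lia.
- by apply: mulP uz _; rewrite vab; lia.
- exact: pideal0.
- exact: pideal0.
- exact: pidealN.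
- exact: pideal0.
- exact: pideal0.
- exact: Xay.
Qed.

End Support.
End BesselData.

(** * Evaluation of the Bessel integral of the translated minimal vector *)

Theorem proposition3p8 (R : realType) (F : localFieldType)
  (char0 : [pchar F] =i pred0)
  (p : nat) (hp : residual_char F p) (oddp : odd p)
  (varpi : F) (hvarpi : uniformizer varpi)
  (psi : F -> R[i]) (psi_char : add_character psi)
  (psi_o : forall x, ointegers x -> psi x = 1)
  (psi_p : exists2 x, pideal (-1) x & psi x <> 1)
  (mu : {sigma_finite_measure set (borelF F) -> \bar R}) (hmu : is_haarF mu)
  (nu : {measure set (borelZG F) -> \bar R}) (hnu : is_haarZG nu)
  (t : F) (ht : ounits t)
  (eps : bool)
  (a : F) (ha : ointegers (- a)) (ha_nsq : ~ exists x : F, x ^+ 2 = - a)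
  (L : fieldExtType F) (s : L) (hs : s ^+ 2 = (- a)%:A)
  (hL : <<1; s>>%VS = fullv)
  (Lambda : L -> R[i]) (Lambda_char : ext_character s Lambda)
  (Lambda_F : forall x : F, x != 0 -> Lambda x%:A = 1)
  (m0 : nat) (hm0 : is_min (trivial_at_level varpi s Lambda) m0)
  (m0_ge2 : (2 <= m0)%N) (m0_a : nval a <= 2 * m0%:Z - 3)
  (u0 : F) (hu0 : ounits u0)
  (hu0_Lambda : forall y : F, ointegers y ->
     Lambda (1 + (varpi ^+ m0.-1 * y) *: s) = psi (varpi^-1 * u0 * y))
  (alpha beta : F)
  (halpha : exists2 x, pideal 1 x & alpha = varpi ^ (1 - m0%:Z) * u0 * (1 + x))
  (hbeta : exists2 x, pideal 1 x & beta = varpi * (1 + x)) :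
  let v := rtrans (invmx (dmx alpha beta)) (fmin eps psi varpi t) in
  cInd eps psi varpi t v /\
  bessel mu nu psi varpi t a s Lambda v = (resq F)%:R ^ (7 - 4 * m0%:Z).
Proof.
have [w0 w1] := hvarpi; have [t0 tv0] := ht; have [u00 u0v] := hu0.
have [xa xa1 alphaE] := halpha; have [xb xb1 betaE] := hbeta.
have unit1 (x : F) : pideal 1 x -> 1 + x != 0 /\ nval (1 + x) = 0.
  move=> x1; have x1' : pideal 1 (1 + x - 1) by rewrite addrAC subrr add0r.
  by split; [exact: unit1_neq0 | exact: nval_unit1].
have [xa0 xav] := unit1 _ xa1; have [xb0 xbv] := unit1 _ xb1.
have wz0 (k : int) : varpi ^ k != 0 by rewrite expfz_neq0.
have alpha0 : alpha != 0 by rewrite alphaE !mulf_neq0.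
have beta0 : beta != 0 by rewrite betaE mulf_neq0.
have valpha : nval alpha = 1 - m0%:Z.
  by rewrite alphaE !nvalM ?mulf_neq0// nvalXz// w1 u0v xav; lia.
have vbeta : nval beta = 1 by rewrite betaE nvalM// w1 xbv; lia.
have a_int : pideal 0 a by rewrite -[a]opprK; exact: pidealN.
(* A zero of 1 + a y^2 would make y^-1 a square root of - a. Hence 1 + y sqrt(-a) gives an element
   of the torus for every y in F. *)
have D0 (y : F) : 1 + a * y ^+ 2 != 0.
  apply/eqP => D; apply: ha_nsq; exists y^-1.
  have y0 : y != 0.
    by apply/eqP => y0; move/eqP: D; rewrite y0 expr0n mulr0 addr0 oner_eq0.
  apply: (mulIf (expf_neq0 2 y0)).
  by rewrite exprVn mulVf ?expf_neq0// mulNr -[LHS]subr0 -D; ring.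
set d := dmx alpha beta.
have Gd : GSp4 d by exact: GSp4_dmx.
move=> v; split; first exact: fmin_translate_cInd.
have inner_v g : inner nu varpi t (rtrans g v) v =
    fmin eps psi varpi t (d *m g *m invmx d).
  exact: (inner_fmin eps psi_char psi_o hvarpi ht hp hnu g Gd).
have vv : inner nu varpi t v v = 1.
  (* Inserting translation by 1 turns the norm into a matrix coefficient, namely [fmin] at the
     identity. *)
  have {1}-> : v = rtrans 1%:M v by apply/funext => x; rewrite /rtrans mulmx1.
  by rewrite inner_v mulmx1 mulmxV ?GSp4_unit// fmin1.
pose B : set (F * F * F) := boxN (m0%:Z - 2) (-1) (2 * m0%:Z - 3).
have coef (y : F) n : pideal (m0%:Z - 1) y -> B n ->
    fmin eps psi varpi t (d *m (TSembed (TSmx a 1 y) *m nmat n) *m invmx d) *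
      (Lambda (phiS s (TSmx a 1 y)))^-1 * (theta psi a n)^-1 = 1.
  move=> yP nB.
  have KX := support_Kprime m0_ge2 a_int alpha0 valpha beta0 vbeta (D0 y) yP nB.
  have zu := support_zu m0_ge2 yP nB.
  have wu := support_wu m0_ge2 a_int yP nB.
  (* The unit [u0] describes Lambda through a parameter in o, so y is rescaled by varpi^(m0 - 1). *)
  pose y' := varpi ^- m0.-1 * y.
  have y'o : pideal 0 y'.
    apply: pideal_mul (pideal_nval (erefl _)) yP _.
    by rewrite nvalV ?expf_neq0// nvalX// w1 natz; lia.
  have yE : y = varpi ^+ m0.-1 * y' by rewrite mulVKf// expf_neq0.
  have LE : Lambda (phiS s (TSmx a 1 y)) = psi (varpi^-1 * u0 * y').
    rewrite -hu0_Lambda// /phiS !mxE /= -yE.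
    by congr (Lambda (_ + _)); rewrite scale1r.
  rewrite fmin_Hprime; last exact/Hgrp_Hprime/Kprime_Hgrp.
  rewrite chi_pm_Kprime// /theta LE.
  suff -> : psi (varpi^-1 * minlevel varpi t
      (d *m (TSembed (TSmx a 1 y) *m nmat n) *m invmx d)) =
    psi (varpi^-1 * u0 * y') * psi (a * n.2 + n.1.2).
    by rewrite -mulrA -invfM divff// mulf_neq0 ?(psi_neq0 psi_char).
  rewrite -(psiD psi_char); apply: (psi_congr psi_char psi_o).
  rewrite dmx_conj_TSembed_nmat// /minlevel !mxE /=.
  (* After removal of the leading terms of alpha y and beta w, three errors remain, all integral:
     [xa] in p offsets varpi^-1, [xb] in p offsets w - a y u in p^(-1), and z + y u lies in p^(2 m0
     - 3), contained in p since m0 >= 2. The last one also absorbs the term a z of theta. *)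
  rewrite (_ : _ - _ = varpi^-1 * u0 * y' * xa + (xb * (n.1.2 - a * y * n.1.1) -
      a * (n.2 + y * n.1.1))).
    apply: pidealD.
      apply: pideal_mul _ xa1 (_ : 0 <= -1 + 1); last by [].
      apply: pideal_mul _ y'o (_ : -1 <= -1 + 0); last by [].
      by apply: pideal_nval; rewrite nvalM ?invr_neq0// nvalV// w1 u0v.
    apply: pidealB; first by apply: pideal_mul xb1 wu _.
    by apply: pideal_mul a_int zu _; lia.
  rewrite [in alpha * y]yE alphaE betaE.
  have -> : varpi ^ (1 - m0%:Z) = varpi ^- m0.-1.
    by rewrite exprnN; congr (_ ^ _); lia.
  by field; rewrite w0 expf_neq0.
have coef0 (y : F) n : ~ (pideal (m0%:Z - 1) y /\ B n) ->
    fmin eps psi varpi t (d *m (TSembed (TSmx a 1 y) *m nmat n) *m invmx d) = 0.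
  move=> yn; apply: fmin_eq0 => HX; apply: yn.
  exact: (Hprime_support m0_ge2 a_int alpha0 valpha beta0 vbeta (D0 y) w0 t0 HX).
rewrite /bessel vv invr1 mul1r /TSintegral.
(* The constant is the volume q^(6 - 3 m0) of the box in N; the volume q^(1 - m0) of the range of y
   supplies the rest of the exponent. *)
rewrite (@cintegral_cst_on _ _ _ mu _ (pideal (m0%:Z - 1)) _
  ((resq F)%:R ^ (- (m0%:Z - 2 + -1 + (2 * m0%:Z - 3))))%:C%C)//.
- have qF : ((resq F)%:R : R) != 0 by rewrite pnatr_eq0 -lt0n resq_gt0.
  rewrite haar_pideal// -rmorphM /= -expfzDr// rmorphXz /= ?rmorph_nat ?unitfE//.
  by congr (_ ^ _); lia.
- exact: measurable_pideal.
- move=> y yP; rewrite (stable_integral_boxN hmu (c := 1) (i := m0%:Z - 2) (j := -1)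
    (k := 2 * m0%:Z - 3)).
  (* For y in p^(m0 - 1) the number 1 + a y^2 lies in 1 + p, so the density of the torus measure is
     1. *)
  + rewrite mulr1 /vabs (negPf (D0 y)) nval_unit1 ?oppr0 ?expr0z ?invr1 ?mulr1//.
    rewrite addrAC subrr add0r expr2; apply: pideal_mul a_int (pidealM yP yP) _; lia.
  + by move=> n nB; rewrite inner_v coef.
  + by move=> n nB; rewrite inner_v coef0 ?mul0r// => -[].
(* Outside that range the integrand over N vanishes identically, and any box gives the value 0. *)
- move=> y yP; rewrite (stable_integral_boxN hmu (c := 0) (i := 0) (j := 0) (k := 0)).
  + by rewrite mulr0 mul0r.
  + by move=> n _; rewrite inner_v coef0 ?mul0r// => -[].
  + by move=> n _; rewrite inner_v coef0 ?mul0r// => -[].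
Qed.
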